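(* Let $q>0$. There exist constants $c,C>0$ depending only on $q$ such that the following holds. Suppose there is $D_n\ge1$ such that $\|h_j(X_1,\dots,X_r)-\theta_j\|_{\psi_q}\le D_n$ for all $1\le j\le d$. If $r^2\log(d)/n\le c$, then $$\mathbb{E}\left[\max_{1\le j\le d}\left|(U_{n,j}-\theta_j)-\frac rn\sum_{i=1}^n\big(g_j(X_i)-\theta_j\big)\right|\right]\le C\,\frac{r^2\log^{1+1/q}(d)\,D_n}{n}.$$
   Context: $n\ge4$, $d\ge3$, $2\le r\le n$ are integers. $X_1,\dots,X_n$ are i.i.d. random variables in a measurable space $(S,\mathcal{S})$, and $h:S^r\to\mathbb{R}^d$ is symmetric and measurable with $\mathbb{E}|h_j(X_1,\dots,X_r)|<\infty$ for all $j$. $I_{n,r}=\{\iota=(i_1,\dots,i_r):1\le i_1<\dots<i_r\le n\}$, and $U_n=|I_{n,r}|^{-1}\sum_{\iota\in I_{n,r}}h(X_{i_1},\dots,X_{i_r})$ with coordinates $U_{n,j}$. $\theta=\mathbb{E}[h(X_1,\dots,X_r)]$ and $g(x_1)=\mathbb{E}[h(x_1,X_2,\dots,X_r)]$. For a real random variable $\xi$ and $q>0$, $\|\xi\|_{\psi_q}=\inf\{C>0:\mathbb{E}[e^{(|\xi|/C)^q}-1]\le1\}$. $\log^a(x)=(\log x)^a$. *)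

(* Defs.v *)
From HB Require Import structures.
From mathcomp Require Import all_boot all_order all_algebra all_fingroup.
From mathcomp Require Import all_classical all_reals all_analysis.

Set Implicit Arguments.
Unset Strict Implicit.
Unset Printing Implicit Defensive.

Import Order.TTheory GRing.Theory Num.Theory.
Import numFieldNormedType.Exports.

Local Open Scope classical_set_scope.
Local Open Scope ring_scope.

(* The values are extended reals, so that the norm is +oo when no C qualifies;
   the plain real [inf] of the empty set would be 0. *)
Definition psi_norm (dO : measure_display) (Omega : measurableType dO)
    (R : realType) (P : probability Omega R) (q : R) (xi : Omega -> R) : \bar R :=
  ereal_inf [set C%:E | C in
    [set C : R | 0 < C /\
      ('E_P[fun w => (expR ((`|xi w| / C) `^ q) - 1)%R] <= 1)%E]].

Section iid.
Context (dO dS : measure_display) (Omega : measurableType dO)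
  (S : measurableType dS) (R : realType) (P : probability Omega R) (n : nat).

Definition mutually_independent (X : 'I_n -> {RV P >-> S}) : Prop :=
  forall (J : {set 'I_n}) (A : 'I_n -> set S),
    (forall i, i \in J -> measurable (A i)) ->
    P (\bigcap_(i in [set` J]) (X i @^-1` A i)) =
    (\prod_(i in J) P (X i @^-1` A i))%E.

Definition identically_distributed (X : 'I_n -> {RV P >-> S}) : Prop :=
  forall (i j : 'I_n) (A : set S), measurable A ->
    distribution P (X i) A = distribution P (X j) A.

Definition iid (X : 'I_n -> {RV P >-> S}) : Prop :=
  mutually_independent X /\ identically_distributed X.

End iid.

Definition symmetric_kernel (S V : Type) (r : nat) (h : r.-tuple S -> V) : Prop :=
  forall (s : 'S_r) (x : r.-tuple S), h [tuple tnth x (s k) | k < r] = h x.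

Definition increasing_indices (n r : nat) : {set r.-tuple 'I_n} :=
  [set t : r.-tuple 'I_n | sorted ltn (map val t)].

Definition first_indices (n r : nat) (le_rn : (r <= n)%N) : r.-tuple 'I_n :=
  [tuple widen_ord le_rn k | k < r].

Section Ustatistic.
Context (dO dS : measure_display) (Omega : measurableType dO)
  (S : measurableType dS) (R : realType) (P : probability Omega R)
  (n d r : nat).
Variables (X : 'I_n -> {RV P >-> S}) (h : r.-tuple S -> d.-tuple R).

Definition subsample (t : r.-tuple 'I_n) (w : Omega) : r.-tuple S :=
  [tuple X (tnth t k) w | k < r].

Definition kernel_rv (t : r.-tuple 'I_n) (j : 'I_d) (w : Omega) : R :=
  tnth (h (subsample t w)) j.

Definition Ustat (j : 'I_d) (w : Omega) : R :=
  (#|increasing_indices n r|%:R)^-1 *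
    \sum_(t in increasing_indices n r) kernel_rv t j w.

Definition theta (le_rn : (r <= n)%N) (j : 'I_d) : R :=
  fine 'E_P[kernel_rv (first_indices le_rn) j].

(* [fine] sends an infinite expectation to 0; when the kernel is integrable
   this only affects x in a null set of the common law of the X i. *)
Definition projection (le_rn : (r <= n)%N) (j : 'I_d) (x : S) : R :=
  fine 'E_P[fun w => tnth (h [tuple if val k == 0%N then x
                                    else X (widen_ord le_rn k) w | k < r]) j].

End Ustatistic.

(* Main.v *)
Require Import Defs.
From HB Require Import structures.
From mathcomp Require Import all_boot all_order all_algebra all_fingroup.
From mathcomp Require Import all_classical all_reals all_analysis.
From mathcomp Require Import measurable_realfun ring lra.

(** The quantity to bound is, in each coordinate [j], the part [T_j] of order
    at least two in the Hoeffding decomposition of the U-statistic.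

    The maximum over [j] and the psi_q norm are dealt with by a single choice
    of moment.  If [E T_j ^ p <= B ^ p] for every [j] and [p >= log d], then
    [E max_j |T_j|] is of order [B] ([expectation_bigmax_le]); and a psi_q norm
    at most [D] bounds the [L^p] norm of [h_j - theta_j] by a constant times
    [D p^(1/q)] ([psi_norm_moment]).  With [p] an even integer of order [log d],
    the theorem becomes the scalar estimate
      [ ||T||_p <= C p (r^2 / n) ||h - theta||_p ].

    The scalar estimate is a second-order Efron-Stein inequality.  Write
    [average B] for the operator that integrates out the coordinates in [B],
    and [increment i = id - average {i}].  A one-coordinate martingale step,
      [ ||f||_p^2 <= ||average {i} f||_p^2 + 5 p ||increment i f||_p^2 ],
    ([moment_step]) iterated over the coordinates ([moment_iter]) bounds
    [||f||_p^2] by the sum of the squared norms of the increments of [f] as soon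
    as the full average of [f] vanishes.  It is applied to [T], and again to
    each [increment i T] in the coordinates other than [i].  Both times the
    average vanishes, because integrating out all the coordinates but one
    annihilates [T] ([average_second_order_part_eq0]).  There remain the
    iterated increments [increment j (increment i T)]: they kill the linear part
    of [T] and every term of the U-statistic whose index tuple does not contain
    both [i] and [j].  The surviving tuples form a proportion
    [r (r - 1) / (n (n - 1))] of all of them ([card_increasing2]), so that each
    iterated increment has norm at most [4 r (r - 1) / (n (n - 1))] times the
    norm of the kernel; summing over the [n ^ 2] pairs gives the factor
    [p (r^2 / n)].

    The operators are studied on bounded measurable functions, where every
    partial integral exists at every point and [average] turns unions of sets of
    coordinates into compositions ([average_average]).  A general kernel is
    clamped at level [N] after centring; the clamped [T] converges almost surely
    as [N] grows, and Fatou's lemma transfers the moment bound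
    ([second_order_part_integral_moment]). *)

Set Implicit Arguments.
Unset Strict Implicit.
Unset Printing Implicit Defensive.

Import Order.TTheory GRing.Theory Num.Theory.
Import numFieldNormedType.Exports.

Local Open Scope classical_set_scope.
Local Open Scope ring_scope.

(** * Inequalities between powers of real numbers *)

Section power_inequalities.
Variable R : realType.
Implicit Types (x y u v a b : R) (m n : nat).

(** The power function lies above its tangents; this is the only form of
    convexity used below, with Jensen's inequality as a consequence. *)
Lemma pow_ge_tangent x y n : 0 <= x -> 0 <= y ->
  y ^+ n + n%:R * y ^+ n.-1 * (x - y) <= x ^+ n.
Proof.
move=> x0 y0; case: n => [|n]; first by rewrite !expr0 !mul0r addr0.
rewrite [n.+1.-1]/=; elim: n => [|n IH]; first by rewrite !expr1 expr0 mulr1 mul1r addrC subrK.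
apply: (@le_trans _ _ (x * (y ^+ n.+1 + n.+1%:R * y ^+ n * (x - y)))); last first.
  by rewrite [leRHS]exprS ler_wpM2l.
rewrite -subr_ge0 (_ : _ - _ = n.+1%:R * y ^+ n * (x - y) ^+ 2).
  by rewrite mulr_ge0 ?sqr_ge0// mulr_ge0// exprn_ge0.
by rewrite !exprS -[n.+2]addn1 -[n.+1]addn1 !natrD; ring.
Qed.

Lemma even_pow_ge0 x m : 0 <= x ^+ (2 * m).
Proof. by rewrite exprM exprn_ge0 ?sqr_ge0. Qed.

Lemma even_pow_norm x m : `|x| ^+ (2 * m) = x ^+ (2 * m).
Proof. by rewrite !exprM real_normK ?num_real. Qed.

Lemma even_pow_ge_tangent x y m :
  y ^+ (2 * m) + (2 * m)%:R * y ^+ (2 * m).-1 * (x - y) <= x ^+ (2 * m).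
Proof.
case: m => [|m]; first by rewrite muln0 !expr0 !mul0r addr0.
have := @pow_ge_tangent (x ^+ 2) (y ^+ 2) m.+1 (sqr_ge0 _) (sqr_ge0 _).
rewrite -!exprM; apply: le_trans.
rewrite -subr_ge0 [m.+1.-1]/= (_ : _ - _ = m.+1%:R * y ^+ (2 * m) * (x - y) ^+ 2).
  by rewrite mulr_ge0 ?sqr_ge0// mulr_ge0// even_pow_ge0.
rewrite natrM (_ : (2 * m.+1).-1 = (2 * m).+1)%N; last by rewrite mulnS.
by rewrite [2%N]lock exprS -lock; ring.
Qed.

Lemma pow_sum_le (I : finType) (A : {set I}) (f : I -> R) m : (0 < m)%N ->
  (\sum_(i in A) f i) ^+ (2 * m) <=
  #|A|%:R ^+ (2 * m).-1 * \sum_(i in A) f i ^+ (2 * m).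
Proof.
move=> m0; have p0 : (2 * m = (2 * m).-1.+1)%N by rewrite prednK// muln_gt0.
have [A0|A0] := posnP #|A|.
  rewrite !big1; first by rewrite p0 expr0n mulr0.
    by move=> i; rewrite (card0_eq A0).
  by move=> i; rewrite (card0_eq A0).
have N0 : #|A|%:R != 0 :> R by rewrite pnatr_eq0 -lt0n.
set S := \sum_(i in A) f i; pose y := S / #|A|%:R.
have -> : S = #|A|%:R * y by rewrite mulrCA divff// mulr1.
rewrite exprMn {1}p0 exprSr -mulrA ler_wpM2l ?exprn_ge0//.
have : \sum_(i in A) (y ^+ (2 * m) + (2 * m)%:R * y ^+ (2 * m).-1 * (f i - y))
    <= \sum_(i in A) f i ^+ (2 * m).
  by apply: ler_sum => i _; exact: even_pow_ge_tangent.
rewrite big_split/= -mulr_sumr sumrB !sumr_const -/S.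
rewrite (_ : S - y *+ #|A| = 0) ?mulr0 ?addr0 -?[_ ^+ _ *+ _]mulr_natl//.
by rewrite -[y *+ _]mulr_natl mulrCA divff// mulr1 subrr.
Qed.

(** Convexity of the even power at [(u + v) / (a + b)], seen as the barycentre of
    [u / a] and [v / b].  When [a] and [b] bound the [L^p] norms of [u] and [v],
    integrating it gives Minkowski's inequality. *)
Lemma convex_pow_add u v a b m : 0 < a -> 0 < b ->
  (u + v) ^+ (2 * m) <= (a + b) ^+ (2 * m) *
    (a / (a + b) * (u / a) ^+ (2 * m) + b / (a + b) * (v / b) ^+ (2 * m)).
Proof.
move=> a0 b0; have ab0 : 0 < a + b by rewrite addr_gt0.
pose y := (u + v) / (a + b).
have -> : u + v = (a + b) * y by rewrite mulrCA divff ?mulr1 ?gt_eqF.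
rewrite exprMn ler_wpM2l ?even_pow_ge0//.
apply: (@le_trans _ _
  (a / (a + b) * (y ^+ (2 * m) + (2 * m)%:R * y ^+ (2 * m).-1 * (u / a - y)) +
   b / (a + b) * (y ^+ (2 * m) + (2 * m)%:R * y ^+ (2 * m).-1 * (v / b - y)))).
  rewrite [leRHS](_ : _ = y ^+ (2 * m) * ((a + b) / (a + b)) +
    (2 * m)%:R * y ^+ (2 * m).-1 *
     ((u * (a / a) + v * (b / b)) / (a + b) - y * ((a + b) / (a + b)))); last by ring.
  by rewrite !divff ?gt_eqF// !mulr1 subrr mulr0 addr0.
by apply: lerD; (apply: ler_wpM2l; [by rewrite divr_ge0 ?ltW|exact: even_pow_ge_tangent]).
Qed.

(** The remainder [R_n] at exponent [n] satisfies
    [R_(n+1) = (u + v) R_n + n u ^ (n - 1) v ^ 2], so induction replaces the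
    binomial expansion. *)
Lemma taylor_pow u v n :
  `|(u + v) ^+ n.+2 - u ^+ n.+2 - n.+2%:R * u ^+ n.+1 * v| <=
  n.+2%:R ^+ 2 / 2 * (v ^+ 2 * (`|u| + `|v|) ^+ n).
Proof.
elim: n => [|n IH].
  rewrite (_ : _ - _ - _ = v ^+ 2); last by ring.
  by rewrite ger0_norm ?sqr_ge0// expr0 mulr1 ler_peMl ?sqr_ge0//; lra.
set s := `|u| + `|v| in IH *.
have s0 : 0 <= s by rewrite addr_ge0.
rewrite (_ : _ - _ - _ = (u + v) *
    ((u + v) ^+ n.+2 - u ^+ n.+2 - n.+2%:R * u ^+ n.+1 * v) +
    n.+2%:R * u ^+ n.+1 * v ^+ 2); last first.
  by rewrite [(u + v) ^+ n.+3]exprS [u ^+ n.+3]exprS [u ^+ n.+2]exprS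
    -[n.+3]addn1 natrD; ring.
apply: le_trans (ler_normD _ _) _.
rewrite normrM.
apply: (@le_trans _ _ (s * (n.+2%:R ^+ 2 / 2 * (v ^+ 2 * s ^+ n)) +
    n.+2%:R * (v ^+ 2 * s ^+ n.+1))).
  apply: lerD; first by apply: ler_pM => //; exact: ler_normD.
  rewrite normrM (ger0_norm (sqr_ge0 v)) normrM normrX normr_nat -mulrA ler_wpM2l//.
  by rewrite mulrC ler_wpM2l ?sqr_ge0// lerXn2r ?nnegrE// lerDl.
rewrite -subr_ge0 (_ : _ - _ = 2^-1 * (v ^+ 2 * s ^+ n.+1)).
  by rewrite mulr_ge0 ?invr_ge0// mulr_ge0 ?sqr_ge0 ?exprn_ge0.
by rewrite -[n.+3]addn1 natrD !exprS; field.
Qed.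

Lemma pow_add_le2 a b n : 0 < a -> 0 <= b -> 2 * n%:R * b <= a ->
  (a + b) ^+ n <= 2 * a ^+ n.
Proof.
case: n => [|n] a0 b0 h; first by rewrite !expr0 mulr1; lra.
have ab0 : 0 <= a + b by rewrite addr_ge0// ltW.
have := @pow_ge_tangent a (a + b) n.+1 (ltW a0) ab0.
rewrite [n.+1.-1]/= => t; have : (a + b) ^+ n.+1 <=
    2 * ((a + b) ^+ n.+1 + n.+1%:R * (a + b) ^+ n * (a - (a + b))); last by lra.
rewrite -subr_ge0 (_ : _ - _ = (a + b) ^+ n * (a + b - 2 * n.+1%:R * b)).
  by rewrite mulr_ge0 ?exprn_ge0// subr_ge0 (le_trans h)// lerDl.
by rewrite exprS; ring.
Qed.

Lemma pow_mixed_le y z n : 0 <= y -> 0 <= z ->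
  y ^+ 2 * z ^+ n <= y ^+ n.+2 + z ^+ n.+2.
Proof.
move=> y0 z0; have [yz|zy] := leP y z.
  apply: (@le_trans _ _ (z ^+ n.+2)); last by rewrite lerDr exprn_ge0.
  by rewrite -[n.+2]add2n exprD ler_wpM2r ?exprn_ge0// lerXn2r.
apply: (@le_trans _ _ (y ^+ n.+2)); last by rewrite lerDl exprn_ge0.
by rewrite -[n.+2]add2n exprD ler_wpM2l ?exprn_ge0// lerXn2r ?nnegrE// ltW.
Qed.

(** The second-order expansion in a form that can be integrated term by term:
    when [a] and [b] bound the [L^p] norms of [u] and [v], the last factor has
    mean at most 2, and the middle term has mean zero when [u] does not depend
    on the coordinate in which [v] is centred. *)
Lemma taylor_pow_weighted u v a b m p : 0 < a -> 0 < b -> (0 < m)%N ->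
  p = (2 * m)%N ->
  (u + v) ^+ p <= u ^+ p + p%:R * u ^+ p.-1 * v +
    (p%:R ^+ 2 / 2) * (b ^+ 2 * (a + b) ^+ p.-2) *
    (a / (a + b) * (u / a) ^+ p + (b / (a + b) + 1) * (v / b) ^+ p).
Proof.
move=> a0 b0 m0 pm; have ab0 : 0 < a + b by rewrite addr_gt0.
have pE : p = p.-2.+2 by rewrite pm; case: (m) m0 => // k _; rewrite mulnS.
have h := taylor_pow u v p.-2; rewrite -pE in h.
have p1 : p.-2.+1 = p.-1 by rewrite pE.
rewrite p1 in h.
have {}h := le_trans (ler_norm _) h.
rewrite -addrA -opprD lerBlDl in h; apply: (le_trans h).
rewrite lerD2l -[leRHS]mulrA ler_wpM2l ?divr_ge0 ?sqr_ge0//.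
have -> : v ^+ 2 * (`|u| + `|v|) ^+ p.-2 =
  (b ^+ 2 * (a + b) ^+ p.-2) *
   ((`|v| / b) ^+ 2 * ((`|u| + `|v|) / (a + b)) ^+ p.-2).
  rewrite !expr_div_n real_normK ?num_real//.
  rewrite [RHS](_ : _ = v ^+ 2 * (`|u| + `|v|) ^+ p.-2 * (b ^+ 2 / b ^+ 2)
   * ((a + b) ^+ p.-2 / (a + b) ^+ p.-2)); last by ring.
  by rewrite !divff ?mulr1// expf_neq0// gt_eqF.
apply: ler_wpM2l; first by rewrite mulr_ge0 ?sqr_ge0// exprn_ge0// ltW.
have y0 : 0 <= `|v| / b by rewrite divr_ge0// ltW.
have z0 : 0 <= (`|u| + `|v|) / (a + b) by rewrite divr_ge0 ?addr_ge0// ltW.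
apply: (le_trans (pow_mixed_le _ y0 z0)).
rewrite -pE addrC [X in _ <= _ + X]mulrDl mul1r addrA lerD//.
  rewrite expr_div_n ler_pdivrMr ?exprn_gt0// mulrC.
  have := @convex_pow_add `|u| `|v| a b m a0 b0.
  by rewrite pm !expr_div_n !even_pow_norm.
by rewrite !expr_div_n pm even_pow_norm.
Qed.

(** The two sides of the dichotomy in [moment_step].  When [b] is at most of
    order [a / p], expanding to second order is accurate because
    [(a + b) ^ p <= 2 a ^ p]; when it is larger, the crude bound [a + b] is
    already of the right size. *)
Lemma small_increment_pow_le a b m p : 0 < a -> 0 < b -> (0 < m)%N -> p = (2 * m)%N ->
  2 * p%:R * b <= a ->
  a ^+ p + p%:R ^+ 2 * (b ^+ 2 * (a + b) ^+ p.-2) <=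
  (a ^+ 2 + 10 * m%:R * b ^+ 2) ^+ m.
Proof.
move=> a0 b0 m0 pm ba.
have ab : (a + b) ^+ p.-2 <= 2 * a ^+ p.-2.
  apply: pow_add_le2; rewrite ?(ltW b0)//; apply: le_trans ba.
  rewrite ler_wpM2r ?(ltW b0)// ler_wpM2l// ler_nat.
  by case: (p) => [|[|?]]//; rewrite leqW// leqW.
have x0 : 0 <= a ^+ 2 + 10 * m%:R * b ^+ 2.
  by rewrite addr_ge0 ?sqr_ge0// mulr_ge0 ?sqr_ge0// mulr_ge0.
have := @pow_ge_tangent _ _ m x0 (sqr_ge0 a).
apply: le_trans; rewrite -exprM -pm lerD2l.
have -> : (a ^+ 2) ^+ m.-1 = a ^+ p.-2.
  by rewrite -exprM pm; case: (m) m0 => // k _; rewrite mulnS.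
apply: (@le_trans _ _ (p%:R ^+ 2 * (b ^+ 2 * (2 * a ^+ p.-2)))).
  by rewrite ler_wpM2l ?sqr_ge0// ler_wpM2l ?sqr_ge0.
rewrite pm natrM -subr_ge0.
rewrite (_ : _ - _ = 2 * m%:R ^+ 2 * b ^+ 2 * a ^+ (2 * m).-2); last by ring.
by rewrite mulr_ge0 ?exprn_ge0 ?(ltW a0)// mulr_ge0 ?sqr_ge0// mulr_ge0 ?sqr_ge0.
Qed.

Lemma large_increment_pow_le a b m : 0 < a -> 0 < b -> (0 < m)%N -> a <= 2 * (2 * m)%:R * b ->
  (a + b) ^+ (2 * m) <= (a ^+ 2 + 10 * m%:R * b ^+ 2) ^+ m.
Proof.
move=> a0 b0 m0 ab; rewrite exprM lerXn2r ?nnegrE ?sqr_ge0//.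
  by rewrite addr_ge0 ?sqr_ge0// mulr_ge0 ?sqr_ge0// mulr_ge0.
have m1 : 1 <= m%:R :> R by rewrite ler1n.
have : a * b <= 4 * m%:R * b ^+ 2.
  apply: le_trans (_ : (2 * (2 * m)%:R * b) * b <= _).
    by rewrite ler_wpM2r ?(ltW b0).
  by rewrite natrM le_eqVlt; apply/orP; left; apply/eqP; ring.
have : b ^+ 2 <= m%:R * b ^+ 2 by rewrite ler_peMl ?sqr_ge0.
move=> h1 h2; rewrite sqrrD mulr2n; nra.
Qed.

End power_inequalities.

(** * Laws of random tuples are determined by boxes *)

Definition box (T : Type) (n : nat) (A : 'I_n -> set T) : set (n.-tuple T) :=
  [set x | forall i, A i (tnth x i)].

Section boxes.
Context (d : measure_display) (S : measurableType d) (n : nat).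

Definition boxes : set (set (n.-tuple S)) :=
  [set B | exists2 A : 'I_n -> set S, (forall i, measurable (A i)) & B = box A].

Lemma boxT : box (fun=> setT) = [set: n.-tuple S].
Proof. by apply/seteqP; split. Qed.

Lemma measurable_box (A : 'I_n -> set S) :
  (forall i, measurable (A i)) -> measurable (box A).
Proof.
move=> mA; rewrite (_ : box A = \bigcap_(i in [set: 'I_n]) (@tnth n S ^~ i @^-1` A i)).
  apply: fin_bigcap_measurable; first exact: finite_finset.
  by move=> i _; rewrite -[X in measurable X]setTI; exact: measurable_tnth.
by apply/seteqP; split=> x; [move=> h i _; exact: h|move=> h i; exact: h].
Qed.

Lemma boxes_setI : setI_closed boxes.
Proof.
move=> _ _ [A mA ->] [B mB ->]; exists (fun i => A i `&` B i).
  by move=> i; exact: measurableI.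
by apply/seteqP; split=> x; [case=> hA hB i; split|move=> h; split=> i; case: (h i)].
Qed.

(** The sigma-algebra of tuples is generated by the preimages of single
    coordinates, which are boxes with a single nontrivial side; unlike these,
    boxes are stable under intersection. *)
Lemma measurable_tupleE : @measurable _ (n.-tuple S) = <<s boxes >>.
Proof.
apply/seteqP; split; last first.
  apply: smallest_sub; first exact: sigma_algebra_measurable.
  by move=> _ [A mA ->]; exact: measurable_box.
apply: smallest_sub; first exact: smallest_sigma_algebra.
rewrite -bigcup_seq => _ [i _ [A mA <-]]; apply: sub_sigma_algebra.
exists (fun j => if j == i then A else setT); first by move=> j; case: eqP.
rewrite setTI; apply/seteqP; split=> x /=.
  by move=> Ax j; case: eqP => // ->.
by move=> /(_ i); rewrite eqxx.
Qed.

End boxes.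

Section law.
Context (R : realType) (d : measure_display) (S : measurableType d) (n : nat).
Context (d1 d2 : measure_display) (T1 : measurableType d1) (T2 : measurableType d2).
Context (P1 : probability T1 R) (P2 : probability T2 R).
Variables (Y1 : T1 -> n.-tuple S) (Y2 : T2 -> n.-tuple S).
Hypotheses (mY1 : measurable_fun setT Y1) (mY2 : measurable_fun setT Y2).
Hypothesis eq_box : forall A : 'I_n -> set S, (forall i, measurable (A i)) ->
  P1 (Y1 @^-1` box A) = P2 (Y2 @^-1` box A).

(** By the uniqueness theorem for an intersection-stable generating class, laws of
    tuples can be compared on boxes, without naming a product measure. *)
Lemma eq_law (B : set (n.-tuple S)) : measurable B ->
  P1 (Y1 @^-1` B) = P2 (Y2 @^-1` B).
Proof.
pose M1 : {RV P1 >-> n.-tuple S} := HB.pack Y1 (isMeasurableFun.Build _ _ _ _ _ mY1).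
pose M2 : {RV P2 >-> n.-tuple S} := HB.pack Y2 (isMeasurableFun.Build _ _ _ _ _ mY2).
apply: (@measure_unique _ R _ (@boxes _ S n) (fun=> setT) _ _ _ _
  (distribution P1 M1) (distribution P2 M2)).
- exact: measurable_tupleE.
- exact: boxes_setI.
- by move=> _; exists (fun=> setT); rewrite ?boxT.
- by rewrite bigcup_const//; exists 0%N.
- by move=> _ [A mA ->]; exact: eq_box.
- by move=> _; rewrite (le_lt_trans (probability_le1 _ _))// ltry.
Qed.

Lemma ge0_eq_integral_law (f : n.-tuple S -> \bar R) : measurable_fun [set: n.-tuple S] f ->
  (forall x, (0 <= f x)%E) ->
  (\int[P1]_w f (Y1 w) = \int[P2]_w f (Y2 w))%E.
Proof.
move=> mf f0.
have h (d' : measure_display) (T : measurableType d') (P : probability T R) (Y : T -> n.-tuple S) :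
  measurable_fun setT Y -> (\int[P]_w f (Y w) = \int[pushforward P Y]_y f y)%E.
  by move=> mY; rewrite ge0_integral_pushforward// => y _; exact: f0.
rewrite !h//; apply: eq_measure_integral => A mA _.
exact: eq_law.
Qed.

Lemma eq_integral_law (f : n.-tuple S -> \bar R) : measurable_fun [set: n.-tuple S] f ->
  (\int[P1]_w f (Y1 w) = \int[P2]_w f (Y2 w))%E.
Proof.
move=> mf; rewrite [LHS]integralE [RHS]integralE.
have fp := measurable_funepos mf; have fn := measurable_funeneg mf.
congr (_ - _)%E; [under eq_integral do rewrite (funepos_comp f Y1)/=;
  under [RHS]eq_integral do rewrite (funepos_comp f Y2)/= |
  under eq_integral do rewrite (funeneg_comp f Y1)/=;
  under [RHS]eq_integral do rewrite (funeneg_comp f Y2)/=];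
  exact: ge0_eq_integral_law.
Qed.

Lemma eq_Rintegral_law (f : n.-tuple S -> R) : measurable_fun [set: n.-tuple S] f ->
  \int[P1]_w f (Y1 w) = \int[P2]_w f (Y2 w).
Proof.
move=> mf; congr fine; apply: (@eq_integral_law (EFin \o f)).
exact/measurable_EFinP.
Qed.

End law.

(** * Tuples of independent and of frozen coordinates *)

Section product_law.
Context (dO dS : measure_display) (Omega : measurableType dO)
  (S : measurableType dS) (R : realType) (P : probability Omega R) (n : nat).
Variables (X : 'I_n -> {RV P >-> S}) (iidX : iid X) (i0 : 'I_n).

Let rho (A : set S) := P (X i0 @^-1` A).

(** The coordinates in [B] are independent copies, the others are frozen at [y].
    The product runs over all [k], so that the products of two such formulas
    can be multiplied factor by factor. *)
Lemma prob_mixed_box m (t : 'I_m -> 'I_n) (B : {set 'I_m}) (y : 'I_m -> S)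
    (A : 'I_m -> set S) :
  {in B &, injective t} -> (forall k, measurable (A k)) ->
  P [set w | forall k, A k (if k \in B then X (t k) w else y k)] =
  (\prod_k (if k \in B then rho (A k) else ((y k \in A k)%:R)%:E))%E.
Proof.
move=> tinj mA.
have [/forallP yA|/existsP[k]] := boolP [forall k, (k \in B) || (y k \in A k)];
    last first.
  rewrite negb_or => /andP[kB ykA].
  rewrite (_ : [set w | _] = set0) ?measure0; last first.
    apply/seteqP; split=> // w /(_ k).
    by rewrite (negbTE kB) => Ayk; move: ykA; rewrite notin_setE; exact.
  by rewrite (bigD1 k)//= (negbTE kB) (negbTE ykA) mul0e.
(* t need not be injective outside B; the intersection has at most one
   nontrivial member, by injectivity on B. *)
pose A' i := \bigcap_(k in [set k | (k \in B) && (t k == i)]) A k.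
have A'E k : k \in B -> A' (t k) = A k.
  move=> kB; apply/seteqP; split=> x; first by apply; rewrite /= kB eqxx.
  by move=> Ax l /= /andP[lB /eqP/tinj ->].
have -> : [set w | forall k, A k (if k \in B then X (t k) w else y k)] =
    \bigcap_(i in [set` t @: B]) (X i @^-1` A' i).
  apply/seteqP; split=> w.
    move=> h i /= /imsetP[k kB ->]; rewrite /= A'E//.
    by have := h k; rewrite kB.
  move=> h k; have := yA k; case: ifPn => [kB _|_ /=]; last by rewrite inE.
  by rewrite -A'E//; apply: (h (t k)) => /=; exact: imset_f.
have mA' i : measurable (A' i).
  by apply: fin_bigcap_measurable => //; exact: finite_finset.
rewrite (proj1 iidX)// big_imset//= [RHS](bigID (mem B))/=.
rewrite [X in (_ = _ * X)%E]big1 ?mule1; last first.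
  by move=> k kB; have := yA k; rewrite (negbTE kB)/= => ->.
apply: eq_bigr => k kB; rewrite kB A'E//.
exact: (proj2 iidX (t k) i0 _ (mA k)).
Qed.

End product_law.

(** * Bounded measurable functions *)

Section bounded_measurable.
Context (R : realType) (d : measure_display) (T : measurableType d).
Implicit Types f g : T -> R.

Definition bounded_measurable f :=
  measurable_fun setT f /\ exists M, forall x, `|f x| <= M.

Lemma bounded_measurable_cst (c : R) : bounded_measurable (fun=> c).
Proof. by split; [exact: measurable_cst|exists `|c|]. Qed.

Lemma bounded_measurableD f g : bounded_measurable f -> bounded_measurable g ->
  bounded_measurable (fun x => f x + g x).
Proof.
move=> [mf [M fM]] [mg [N gN]]; split; first exact: measurable_funD.
by exists (M + N) => x; rewrite (le_trans (ler_normD _ _))// lerD.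
Qed.

Lemma bounded_measurableM f g : bounded_measurable f -> bounded_measurable g ->
  bounded_measurable (fun x => f x * g x).
Proof.
move=> [mf [M fM]] [mg [N gN]]; split; first exact: measurable_funM.
by exists (M * N) => x; rewrite normrM ler_pM.
Qed.

Lemma bounded_measurableZ c f : bounded_measurable f ->
  bounded_measurable (fun x => c * f x).
Proof. exact/bounded_measurableM/bounded_measurable_cst. Qed.

Lemma bounded_measurableB f g : bounded_measurable f -> bounded_measurable g ->
  bounded_measurable (fun x => f x - g x).
Proof.
move=> bf /(bounded_measurableZ (-1)) bg.
under eq_fun do rewrite -mulN1r.
exact: bounded_measurableD.
Qed.

Lemma bounded_measurableX f k : bounded_measurable f ->
  bounded_measurable (fun x => f x ^+ k).
Proof.
move=> [mf [M fM]]; split; first exact: measurable_funX.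
by exists (M ^+ k) => x; rewrite normrX lerXn2r ?nnegrE ?(le_trans _ (fM x)).
Qed.

Lemma bounded_measurable_sum (I : Type) (s : seq I) (Q : pred I) (f : I -> T -> R) :
  (forall i, bounded_measurable (f i)) ->
  bounded_measurable (fun x => \sum_(i <- s | Q i) f i x).
Proof.
move=> bf; elim: s => [|i s IH].
  by under eq_fun do rewrite big_nil; exact: bounded_measurable_cst.
under eq_fun do rewrite big_cons; case: (Q i) => //.
exact: bounded_measurableD.
Qed.

Lemma bounded_measurable_integrable (P : probability T R) f :
  bounded_measurable f -> P.-integrable setT (EFin \o f).
Proof.
move=> [mf [M fM]]; apply: measurable_bounded_integrable => //.
  by rewrite (le_lt_trans (probability_le1 _ _))// ltry.
exists M; split; first exact: num_real.
by move=> z Mz x _; exact: le_trans (fM x) (ltW Mz).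
Qed.

Lemma Rintegral_cstT (P : probability T R) (c : R) : \int[P]_w c = c.
Proof. by rewrite /Rintegral integral_cst//= probability_setT mule1. Qed.

Lemma Rintegral_norm_le (P : probability T R) f M : measurable_fun setT f ->
  (forall x, `|f x| <= M) -> `|\int[P]_w f w| <= M.
Proof.
move=> mf fM; have bf : bounded_measurable f by split=> //; exists M.
rewrite (le_trans (le_normr_Rintegral _ _))//; first exact: bounded_measurable_integrable.
rewrite -[leRHS](Rintegral_cstT P); apply: le_Rintegral => //.
- apply: bounded_measurable_integrable; split; first exact: measurableT_comp.
  by exists M => x; rewrite normr_id.
- by apply: bounded_measurable_integrable; exact: bounded_measurable_cst.
Qed.

End bounded_measurable.

Lemma bounded_measurable_comp (R : realType) (d d' : measure_display)
    (T : measurableType d) (T' : measurableType d') (g : T' -> T) (f : T -> R) :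
  measurable_fun setT g -> bounded_measurable f -> bounded_measurable (f \o g).
Proof.
move=> mg [mf [M fM]]; split; first exact: measurableT_comp.
by exists M => x; exact: fM.
Qed.

Section parametric_integral.
Context (R : realType) (d1 d2 : measure_display)
  (T1 : measurableType d1) (T2 : measurableType d2) (P : probability T2 R).

(** The extended integral is the difference of two measurable nonnegative ones,
    and [fine] sends its infinite values to 0 measurably; this covers the
    projections of unbounded kernels, infinite on a null set. *)
Lemma measurable_fun_parametric_integral (k : T1 * T2 -> R) :
  measurable_fun setT k -> measurable_fun setT (fun x => \int[P]_w k (x, w)).
Proof.
move=> mk; apply: measurableT_comp; first exact: fine_measurable.
have mEk : measurable_fun setT (EFin \o k) by exact/measurable_EFinP.
rewrite (_ : (fun _ => _) = (fun x => \int[P]_w (EFin \o k)^\+ (x, w)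
    - \int[P]_w (EFin \o k)^\- (x, w)))%E.
  apply: emeasurable_funB; apply: measurable_fun_fubini_tonelli_F => //.
    exact: measurable_funepos.
  exact: measurable_funeneg.
apply/funext => x; rewrite integralE.
by congr (_ - _)%E; apply: eq_integral => w _; rewrite ?funeposE ?funenegE.
Qed.

End parametric_integral.

(** * Integrating out a set of coordinates *)

Definition mix (T : Type) (n : nat) (B : {set 'I_n}) (y x : n.-tuple T) :
  n.-tuple T := [tuple if i \in B then tnth y i else tnth x i | i < n].

Lemma mixT (T : Type) (n : nat) (y x : n.-tuple T) : mix [set: 'I_n]%SET y x = y.
Proof. by apply: eq_from_tnth => i; rewrite tnth_mktuple inE. Qed.

(** The pointwise form of measurability with respect to the coordinates outside
    [B]: such functions are the constants of [average B]. *)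
Definition avoids (T V : Type) (n : nat) (B : {set 'I_n}) (f : n.-tuple T -> V) :=
  forall y x, f (mix B y x) = f x.

Section averaging.
Context (dO dS : measure_display) (Omega : measurableType dO)
  (S : measurableType dS) (R : realType) (P : probability Omega R) (n : nat).
Variables (X : 'I_n -> {RV P >-> S}) (iidX : iid X) (i0 : 'I_n).

Implicit Types (f g : n.-tuple S -> R) (B C : {set 'I_n}).

Local Notation bm := (@bounded_measurable R _ (n.-tuple S)).

Definition sample (w : Omega) : n.-tuple S := [tuple X i w | i < n].

Definition average B f (x : n.-tuple S) : R := \int[P]_w f (mix B (sample w) x).

Definition mean f : R := \int[P]_w f (sample w).

Lemma measurable_sample : measurable_fun setT sample.
Proof.
apply/measurable_fun_tnthP => i; apply: eq_measurable_fun (measurable_funP (X i)).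
by move=> w _ /=; rewrite tnth_mktuple.
Qed.

Lemma measurable_mix B :
  measurable_fun setT (fun z : n.-tuple S * Omega => mix B (sample z.2) z.1).
Proof.
apply/measurable_fun_tnthP => i; have [iB|iB] := boolP (i \in B).
  apply: (@eq_measurable_fun _ _ _ _ _ (X i \o snd)).
    by move=> w _ /=; rewrite !tnth_mktuple iB.
  by apply: measurableT_comp.
apply: (@eq_measurable_fun _ _ _ _ _ ((@tnth n S ^~ i) \o fst)).
  by move=> w _ /=; rewrite !tnth_mktuple (negbTE iB).
by apply: measurableT_comp => //; exact: measurable_tnth.
Qed.

Lemma measurable_mixl B x : measurable_fun setT (fun w => mix B (sample w) x).
Proof. exact: measurableT_comp (measurable_mix B) (measurable_pair1 x). Qed.

Lemma mean_averageT f x : mean f = average [set: 'I_n]%SET f x.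
Proof. by apply: eq_Rintegral => w _; rewrite mixT. Qed.

Lemma bounded_measurable_mix B f x : bm f ->
  bounded_measurable (fun w => f (mix B (sample w) x)).
Proof. exact/bounded_measurable_comp/measurable_mixl. Qed.

Lemma bounded_measurable_average B f : bm f -> bm (average B f).
Proof.
move=> bf; have [mf [M fM]] := bf; split; last first.
  by exists M => x; apply: Rintegral_norm_le => //; case: (bounded_measurable_mix B x bf).
apply: (@measurable_fun_parametric_integral _ _ _ _ _ P
  (fun z => f (mix B (sample z.2) z.1))).
exact: measurableT_comp (measurable_mix B).
Qed.

Lemma averageD B f g x : bm f -> bm g ->
  average B (fun z => f z + g z) x = average B f x + average B g x.
Proof.
by move=> bf bg; rewrite /average RintegralD//;
  apply: bounded_measurable_integrable; exact: bounded_measurable_mix.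
Qed.

Lemma averageB B f g x : bm f -> bm g ->
  average B (fun z => f z - g z) x = average B f x - average B g x.
Proof.
by move=> bf bg; rewrite /average RintegralB//;
  apply: bounded_measurable_integrable; exact: bounded_measurable_mix.
Qed.

Lemma averageMr B f g x : bm f -> bm g -> avoids B f ->
  average B (fun z => f z * g z) x = f x * average B g x.
Proof.
move=> bf bg fB; rewrite /average -RintegralZl//.
  by apply: eq_Rintegral => w _; rewrite fB.
by apply: bounded_measurable_integrable; exact: bounded_measurable_mix.
Qed.

Lemma average_avoids B f x : avoids B f -> average B f x = f x.
Proof.
move=> fB; rewrite /average; under eq_Rintegral do rewrite fB.
exact: Rintegral_cstT.
Qed.

Lemma averageZ B c f x : bm f -> average B (fun z => c * f z) x = c * average B f x.
Proof.
by move=> bf; apply: (averageMr (f := fun=> c)) => //; exact: bounded_measurable_cst.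
Qed.

Lemma average_sum (I : Type) (s : seq I) (Q : pred I) B (f : I -> n.-tuple S -> R) x :
  (forall i, bm (f i)) ->
  average B (fun z => \sum_(i <- s | Q i) f i z) x =
  \sum_(i <- s | Q i) average B (f i) x.
Proof.
move=> bf; elim: s => [|i s IH].
  rewrite big_nil /average; under eq_Rintegral do rewrite big_nil.
  exact: Rintegral_cstT.
rewrite big_cons -IH; case: ifPn => Qi; last first.
  by apply: eq_Rintegral => w _; rewrite big_cons (negbTE Qi).
rewrite -averageD//; last exact: bounded_measurable_sum.
by apply: eq_Rintegral => w _; rewrite big_cons Qi.
Qed.

(** Drawing the coordinates in [B] and then those in [C] afresh, from two
    independent samples, yields the same law as drawing all of [B :|: C] from a
    single sample.  This one identity makes the operators commuting projections
    and lets [average] preserve the mean. *)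
Lemma average_average B C f x : bm f ->
  average B (average C f) x = average (B :|: C) f x.
Proof.
move=> bf; have [mf [M fM]] := bf.
pose Y (z : Omega * Omega) := mix C (sample z.2) (mix B (sample z.1) x).
have mY : measurable_fun setT Y.
  have m2 : measurable_fun setT
      (fun z : Omega * Omega => (mix B (sample z.1) x, z.2)).
    apply: measurable_fun_pair => //=.
    exact: measurableT_comp (measurable_mixl B x) measurable_fst.
  exact: measurableT_comp (measurable_mix C) m2.
transitivity (\int[(P \x P)%E]_z f (Y z)).
  have fY : bounded_measurable (f \o Y) by exact: bounded_measurable_comp.
  rewrite /Rintegral -(integral12_prod_meas1 (bounded_measurable_integrable _ fY)).
  rewrite /fubini_F /average; congr fine; apply: eq_integral => w _.
  rewrite /Rintegral fineK//; apply: integrable_fin_num => //.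
  by apply: bounded_measurable_integrable; exact: bounded_measurable_mix.
apply: eq_Rintegral_law => //; first exact: measurable_mixl.
move=> A mA.
pose A1 i := if i \in C then setT else A i.
pose A2 i := if i \in C then A i else setT.
have mA1 i : measurable (A1 i) by rewrite /A1; case: ifP.
have mA2 i : measurable (A2 i) by rewrite /A2; case: ifP.
pose Z B' A' := [set w | forall i, A' i (if i \in B' then X i w else tnth x i)].
have mZ B' A' : (forall i, measurable (A' i)) -> measurable (Z B' A').
  move=> mA'; rewrite (_ : Z B' A' = (fun w => mix B' (sample w) x) @^-1` box A').
    by rewrite -[X in measurable X]setTI; apply: measurable_mixl => //; exact: measurable_box.
  by apply/seteqP; split=> w h i; have := h i; rewrite !tnth_mktuple.
have -> : Y @^-1` box A = Z B A1 `*` Z C A2.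
  apply/seteqP; split=> -[w w'] /=.
    move=> h; split=> i /=; have := h i; rewrite /A1 /A2 !tnth_mktuple/=.
      by case: ifP.
    by case: ifP.
  move=> [h1 h2] i; have := h1 i; have := h2 i; rewrite /A1 /A2 !tnth_mktuple/=.
  by case: ifP.
transitivity (P (Z B A1) * P (Z C A2))%E.
  by apply: product_measure1E; exact: mZ.
have -> : (fun w => mix (B :|: C) (sample w) x) @^-1` box A = Z (B :|: C) A.
  by apply/seteqP; split=> w h i; have := h i; rewrite !tnth_mktuple.
rewrite /Z !(prob_mixed_box iidX i0 (t := id))// -big_split/=.
apply: eq_bigr => i _; rewrite inE /A1 /A2.
have rT : P (X i0 @^-1` setT) = 1%E by rewrite preimage_setT probability_setT.
case: (i \in B); case: (i \in C) => /=; rewrite ?rT ?in_setT ?mul1e ?mule1//.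
Qed.

Lemma mean_average B f : bm f -> mean (average B f) = mean f.
Proof.
move=> bf; have w0 : n.-tuple S by exact: (sample point).
by rewrite !(mean_averageT _ w0) average_average// finset.setTU.
Qed.

Lemma bounded_measurable_sample f : bm f -> bounded_measurable (f \o sample).
Proof. exact/bounded_measurable_comp/measurable_sample. Qed.

Lemma meanD f g : bm f -> bm g -> mean (fun z => f z + g z) = mean f + mean g.
Proof.
by move=> bf bg; rewrite /mean RintegralD//; apply: bounded_measurable_integrable;
  exact: bounded_measurable_sample.
Qed.

Lemma meanZ c f : bm f -> mean (fun z => c * f z) = c * mean f.
Proof.
by move=> bf; rewrite /mean RintegralZl//; apply: bounded_measurable_integrable;
  exact: bounded_measurable_sample.
Qed.

Lemma mean_le f g : bm f -> bm g -> (forall z, f z <= g z) -> mean f <= mean g.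
Proof.
by move=> bf bg fg; apply: le_Rintegral => //; apply: bounded_measurable_integrable;
  exact: bounded_measurable_sample.
Qed.

Lemma eq_average B f g x : f =1 g -> average B f x = average B g x.
Proof. by move=> fg; apply: eq_Rintegral => w _; rewrite fg. Qed.

Lemma eq_mean f g : f =1 g -> mean f = mean g.
Proof. by move=> fg; apply: eq_Rintegral => w _; rewrite fg. Qed.

Lemma avoids_average B f : avoids B (average B f).
Proof.
move=> y x; apply: eq_Rintegral => w _; congr f.
by apply: eq_from_tnth => i; rewrite !tnth_mktuple; case: (i \in B).
Qed.

(** * The Efron-Stein inequality for even moments *)

Lemma mean_mul_average B f g : bm f -> bm g -> avoids B f ->
  mean (fun z => f z * g z) = mean (fun z => f z * average B g z).
Proof.
move=> bf bg fB; rewrite -(mean_average B); last exact: bounded_measurableM.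
by apply: eq_mean => z; rewrite averageMr.
Qed.

(** Jensen's inequality: integrate the tangent inequality at [average B f], whose
    linear term has mean zero by [mean_mul_average]. *)
Lemma average_contracts B f m : bm f ->
  mean (fun z => average B f z ^+ (2 * m)) <= mean (fun z => f z ^+ (2 * m)).
Proof.
move=> bf; set u := average B f.
have bu : bm u by exact: bounded_measurable_average.
pose l z := (2 * m)%:R * u z ^+ (2 * m).-1.
have bl : bm l by apply: bounded_measurableZ; exact: bounded_measurableX.
have lB : avoids B l by move=> y x; rewrite /l /u avoids_average.
have bfu : bm (fun z => f z - u z) by exact: bounded_measurableB.
have bX g k : bm g -> bm (fun z => g z ^+ k) by exact: bounded_measurableX.
have bM g h : bm g -> bm h -> bm (fun z => g z * h z) by exact: bounded_measurableM.
have <- : mean (fun z => u z ^+ (2 * m) + l z * (f z - u z)) =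
          mean (fun z => u z ^+ (2 * m)).
  rewrite meanD; [|exact: bX|exact: bM].
  rewrite (mean_mul_average (B := B))// [X in _ + X](_ : _ = 0) ?addr0//.
  rewrite (@eq_mean _ (fun=> 0)) ?[LHS]Rintegral_cstT// => z.
  by rewrite averageB// /u average_average// finset.setUid subrr mulr0.
apply: mean_le; [|exact: bX|by move=> z; exact: even_pow_ge_tangent].
by apply: bounded_measurableD; [exact: bX|exact: bM].
Qed.

Lemma mean_weighted_le u v a b c al be m : bm u -> bm v -> 0 < a -> 0 < b ->
  0 <= c -> 0 <= al -> 0 <= be ->
  mean (fun z => u z ^+ (2 * m)) <= a ^+ (2 * m) ->
  mean (fun z => v z ^+ (2 * m)) <= b ^+ (2 * m) ->
  mean (fun z => c * (al * (u z / a) ^+ (2 * m) + be * (v z / b) ^+ (2 * m)))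
    <= c * (al + be).
Proof.
move=> bu bv a0 b0 c0 al0 be0 ua vb.
have bX g k : bm g -> bm (fun z => g z ^+ k) by exact: bounded_measurableX.
have bZ g k : bm g -> bm (fun z => k * g z) by exact: bounded_measurableZ.
rewrite (@eq_mean _ (fun z => c * (al / a ^+ (2 * m) * u z ^+ (2 * m)
   + be / b ^+ (2 * m) * v z ^+ (2 * m)))); last first.
  by move=> z; rewrite !expr_div_n; ring.
have bu' := bZ _ (al / a ^+ (2 * m)) (bX _ (2 * m)%N bu).
have bv' := bZ _ (be / b ^+ (2 * m)) (bX _ (2 * m)%N bv).
rewrite meanZ; last exact: bounded_measurableD.
rewrite meanD// !meanZ; [|exact: bX|exact: bX].
rewrite ler_wpM2l// lerD// mulrAC ler_pdivrMr ?exprn_gt0// ler_wpM2l//.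
Qed.

(** A two-term martingale inequality for [L^p] norms with [p = 2 m], where [A] and
    [D] are bounds on squared norms: orthogonality of [f - average B f] to
    the functions of [average B f] removes the first-order term, so that squared
    norms add up, at the price of a factor proportional to [p]. *)
Lemma moment_step B f (A D : R) m : (0 < m)%N -> bm f -> 0 < A -> 0 < D ->
  mean (fun z => average B f z ^+ (2 * m)) <= A ^+ m ->
  mean (fun z => (f z - average B f z) ^+ (2 * m)) <= D ^+ m ->
  mean (fun z => f z ^+ (2 * m)) <= (A + 10 * m%:R * D) ^+ m.
Proof.
move=> m0 bf A0 D0; pose a := Num.sqrt A; pose b := Num.sqrt D.
have a0 : 0 < a by rewrite sqrtr_gt0.
have b0 : 0 < b by rewrite sqrtr_gt0.
have ab0 : 0 < a + b by rewrite addr_gt0.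
have Aa : A = a ^+ 2 by rewrite sqr_sqrtr// ltW.
have Db : D = b ^+ 2 by rewrite sqr_sqrtr// ltW.
rewrite Aa Db -!exprM; set u := average B f; set v := fun z => f z - u z.
move=> ua vb.
have bu : bm u by exact: bounded_measurable_average.
have bv : bm v by exact: bounded_measurableB.
have bX g k : bm g -> bm (fun z => g z ^+ k) by exact: bounded_measurableX.
have bZ g k : bm g -> bm (fun z => k * g z) by exact: bounded_measurableZ.
have bM g h : bm g -> bm h -> bm (fun z => g z * h z) by exact: bounded_measurableM.
have bDD g h : bm g -> bm h -> bm (fun z => g z + h z) by exact: bounded_measurableD.
have bW c al be : bm (fun z =>
    c * (al * (u z / a) ^+ (2 * m) + be * (v z / b) ^+ (2 * m))).
  apply: (bZ); apply: (bDD); apply: (bZ); apply: (bX).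
    by under eq_fun do rewrite mulrC; exact: bZ.
  by under eq_fun do rewrite mulrC; exact: bZ.
have fE z : f z = u z + v z by rewrite /v addrC subrK.
rewrite (@eq_mean _ (fun z => (u z + v z) ^+ (2 * m))); last by move=> z; rewrite fE.
have buv : bm (fun z => (u z + v z) ^+ (2 * m)) by apply: (bX); exact: bDD.
(* Either b is at least of order a / p and convexity suffices, or it is
   smaller and the expansion to second order is needed. *)
have [ab|/ltW ab] := leP (2 * (2 * m)%:R * b) a; last first.
  apply: le_trans (large_increment_pow_le a0 b0 m0 ab).
  rewrite -[leRHS]mulr1.
  have <- : a / (a + b) + b / (a + b) = 1 by rewrite -mulrDl divff// gt_eqF.
  apply: le_trans (mean_weighted_le bu bv a0 b0 _ _ _ ua vb); first last.
  - by rewrite divr_ge0// ltW.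
  - by rewrite divr_ge0// ltW.
  - exact: even_pow_ge0.
  apply: mean_le => // z; exact: convex_pow_add.
apply: le_trans (small_increment_pow_le a0 b0 m0 erefl ab).
pose K := ((2 * m)%:R ^+ 2 / 2) * (b ^+ 2 * (a + b) ^+ (2 * m).-2).
have -> : (2 * m)%:R ^+ 2 * (b ^+ 2 * (a + b) ^+ (2 * m).-2) =
    K * (a / (a + b) + (b / (a + b) + 1)).
  rewrite addrA -mulrDl divff ?gt_eqF// /K.
  by set x := _%:R; set y := b ^+ 2 * _; field.
pose l z := (2 * m)%:R * u z ^+ (2 * m).-1.
have bl : bm l by apply: (bZ); exact: bX.
have lv0 : mean (fun z => l z * v z) = 0.
  rewrite (mean_mul_average (B := B))//; last first.
    by move=> y x; rewrite /l /u avoids_average.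
  rewrite (@eq_mean _ (fun=> 0)) ?[LHS]Rintegral_cstT// => z.
  by rewrite averageB// /u average_average// finset.setUid subrr mulr0.
apply: (@le_trans _ _ (mean (fun z => (u z ^+ (2 * m) + l z * v z) +
    K * (a / (a + b) * (u z / a) ^+ (2 * m) +
         (b / (a + b) + 1) * (v z / b) ^+ (2 * m))))).
  apply: mean_le => //; last first.
    move=> z; rewrite /l /K. exact: (taylor_pow_weighted _ _ a0 b0 m0 erefl).
  by apply: (bDD) => //; apply: (bDD); [exact: bX|exact: bM].
have bul : bm (fun z => u z ^+ (2 * m) + l z * v z).
  by apply: (bDD); [exact: bX|exact: bM].
rewrite meanD// meanD ?lv0 ?addr0; [|exact: bX|exact: bM].
apply: lerD => //; apply: mean_weighted_le => //.
- by rewrite mulr_ge0 ?divr_ge0 ?sqr_ge0// mulr_ge0 ?sqr_ge0// exprn_ge0// ltW.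
- by rewrite divr_ge0// ltW.
- by rewrite addr_ge0// divr_ge0// ltW.
Qed.

Definition increment i f x := f x - average [set i]%SET f x.

Lemma bounded_measurable_increment i f : bm f -> bm (increment i f).
Proof. by move=> bf; apply: bounded_measurableB => //; exact: bounded_measurable_average. Qed.

(** Increments in the different coordinates inherit their bounds through the
    averaging steps of [moment_iter] because the operators commute. *)
Lemma increment_average B i f x : bm f ->
  increment i (average B f) x = average B (increment i f) x.
Proof.
move=> bf; rewrite /increment averageB//; last exact: bounded_measurable_average.
by rewrite !average_average// finset.setUC.
Qed.

Lemma eq_increment i f g x : f =1 g -> increment i f x = increment i g x.
Proof. by move=> fg; rewrite /increment (eq_average _ _ fg) fg. Qed.

Lemma increment_avoids i f x : avoids [set i]%SET f -> increment i f x = 0.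
Proof. by move=> fi; rewrite /increment average_avoids// subrr. Qed.

Lemma avoids_increment C i f : avoids C f -> avoids C (increment i f).
Proof.
move=> fC y x; rewrite /increment fC; congr (_ - _).
apply: eq_Rintegral => w _; rewrite -[RHS](fC (mix [set i]%SET (sample w) y)); congr f.
by apply: eq_from_tnth => j; rewrite !tnth_mktuple; case: (j \in C); case: (j \in [set i]%SET).
Qed.

(** Minkowski's inequality for [f - average {i} f], both terms of which have norm
    at most that of [f]. *)
Lemma increment_contracts i f m : bm f ->
  mean (fun z => increment i f z ^+ (2 * m)) <=
  4 ^+ m * mean (fun z => f z ^+ (2 * m)).
Proof.
move=> bf; have ba : bm (average [set i]%SET f) by exact: bounded_measurable_average.
have bX g k : bm g -> bm (fun z => g z ^+ k) by exact: bounded_measurableX.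
have bZ g k : bm g -> bm (fun z => k * g z) by exact: bounded_measurableZ.
apply: (@le_trans _ _ (mean (fun z => 4 ^+ m / 2 * f z ^+ (2 * m) +
    4 ^+ m / 2 * average [set i]%SET f z ^+ (2 * m)))).
  apply: mean_le.
  - by apply: (bX); exact: bounded_measurable_increment.
  - by apply: bounded_measurableD; apply: (bZ); exact: bX.
  move=> z; have := @convex_pow_add _ (f z) (- average [set i]%SET f z) 1 1 m ltr01 ltr01.
  rewrite !divr1 [(- _) ^+ (2 * m)]exprM sqrrN -exprM => /le_trans; apply.
  rewrite exprM (_ : (1 + 1) ^+ 2 = 4); last by ring.
  by rewrite (_ : 1 + 1 = 2)// mulrDr !mul1r !mulrA.
rewrite meanD; [|by apply: (bZ); exact: bX|by apply: (bZ); exact: bX].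
rewrite meanZ ?meanZ; [|exact: bX|exact: bX].
apply: (@le_trans _ _ (4 ^+ m / 2 * mean (fun z => f z ^+ (2 * m)) +
    4 ^+ m / 2 * mean (fun z => f z ^+ (2 * m)))).
  by rewrite lerD2l ler_wpM2l ?divr_ge0 ?exprn_ge0//; exact: average_contracts.
by rewrite -mulrDl -splitr.
Qed.

(** Each coordinate of [s] is averaged in turn; the increment met at a later
    stage is an average of the increment of [f] itself, hence not larger. *)
Lemma moment_iter (s : seq 'I_n) f (A D : R) m : (0 < m)%N -> bm f ->
  0 < A -> 0 < D ->
  mean (fun z => average [set i in s]%SET f z ^+ (2 * m)) <= A ^+ m ->
  (forall i, i \in s -> mean (fun z => increment i f z ^+ (2 * m)) <= D ^+ m) ->
  mean (fun z => f z ^+ (2 * m)) <= (A + (size s)%:R * (10 * m%:R * D)) ^+ m.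
Proof.
move=> m0 bf A0 D0; elim: s f bf => [|i s IH] f bf fA fD.
  rewrite mul0r addr0; apply: le_trans fA; rewrite le_eqVlt; apply/orP; left; apply/eqP.
  apply: eq_mean => z; rewrite average_avoids// => y x.
  by congr f; apply: eq_from_tnth => i; rewrite tnth_mktuple inE.
have bif : bm (average [set i]%SET f) by exact: bounded_measurable_average.
rewrite [size _]/= -[(size s).+1]addn1 natrD mulrDl mul1r addrA.
have mD : 0 <= 10 * m%:R * D by rewrite mulr_ge0 ?(ltW D0)// mulr_ge0.
apply: (moment_step (B := [set i]%SET) m0 bf) => //.
- by rewrite ltr_wpDr// mulr_ge0.
- apply: IH => //.
    apply: le_trans fA; rewrite le_eqVlt; apply/orP; left; apply/eqP.
    apply: eq_mean => z; rewrite average_average//; congr (average _ f z ^+ _).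
    by apply/setP => j; rewrite !inE orbC.
  move=> j js; apply: le_trans (fD j _); last by rewrite inE js orbT.
  under eq_fun do rewrite increment_average//.
  by apply: average_contracts; exact: bounded_measurable_increment.
- by apply: (fD i); rewrite inE eqxx.
Qed.

(** Two rounds of [moment_iter].  The inner one is applied to [increment i f] over
    the coordinates other than [i], the outer one to [f] over all coordinates;
    each costs a factor of order [m n] on squared norms. *)
Lemma second_order_moment f (D : R) m : (0 < m)%N -> bm f -> 0 < D ->
  (forall k x, average (~: [set k])%SET f x = 0) ->
  (forall i j, i != j ->
    mean (fun z => increment j (increment i f) z ^+ (2 * m)) <= D ^+ m) ->
  mean (fun z => f z ^+ (2 * m)) <= (200 * m%:R ^+ 2 * n%:R ^+ 2 * D) ^+ m.
Proof.
move=> m0 bf D0 f0 fD.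
have n0 : (0 < n)%N by case: (n) i0 => [[]|].
have m1 : 1 <= m%:R :> R by rewrite ler1n.
have n1 : 1 <= n%:R :> R by rewrite ler1n.
have p0 : (0 < 2 * m)%N by rewrite muln_gt0.
have m00 (A : R) B g : 0 < A -> (forall x, average B g x = 0) ->
    mean (fun z => average B g z ^+ (2 * m)) <= A ^+ m.
  move=> A0 g0; rewrite (@eq_mean _ (fun=> 0)) ?[leLHS]Rintegral_cstT ?exprn_ge0 ?(ltW A0)//.
  by move=> z; rewrite g0 expr0n gtn_eqF.
have fT (k : 'I_n) x : average [set: 'I_n]%SET f x = 0.
  rewrite -(finset.setUCr [set k]%SET) -average_average//.
  rewrite average_avoids// => y z; by rewrite !f0.
pose D1 := 10 * m%:R * n%:R * D.
have D10 : 0 < D1 by rewrite !mulr_gt0// ltr0n.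
have h1 i : mean (fun z => increment i f z ^+ (2 * m)) <= D1 ^+ m.
  have := @moment_iter (enum (~: [set i])%SET) _ D D m m0
    (bounded_measurable_increment i bf) D0 D0.
  rewrite set_enum.
  have /[swap]/[apply] : mean (fun z =>
      average (~: [set i])%SET (increment i f) z ^+ (2 * m)) <= D ^+ m.
    apply: m00 => // x; rewrite -increment_average// /increment.
    by rewrite average_average// f0 finset.setUCr (fT i) subrr.
  move=> h; apply: le_trans (h _) _ => [j|].
    by rewrite mem_enum !inE => ji; apply: fD; rewrite eq_sym.
  rewrite lerXn2r ?nnegrE ?(ltW D10)//.
    by rewrite addr_ge0 ?(ltW D0)// mulr_ge0// mulr_ge0 ?(ltW D0)// mulr_ge0.
  rewrite -cardE cardsC1 card_ord.
  have nE : n%:R = n.-1%:R + 1 :> R by rewrite natr1 prednK.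
  rewrite /D1 nE.
  have Dm : 0 <= m%:R * D - D by rewrite subr_ge0 ler_peMl// ltW.
  rewrite -subr_ge0.
  rewrite [leRHS](_ : _ = 9 * (m%:R * D) + (m%:R * D - D)); last by ring.
  by rewrite addr_ge0// mulr_ge0// mulr_ge0// ltW.
have := @moment_iter (enum [set: 'I_n]%SET) f D1 D1 m m0 bf D10 D10.
rewrite set_enum => /(_ (m00 _ _ _ D10 (fT i0))) h; apply: le_trans (h _) _ => //.
rewrite lerXn2r ?nnegrE//.
- by rewrite addr_ge0 ?(ltW D10)// mulr_ge0// mulr_ge0 ?(ltW D10)// mulr_ge0.
- by rewrite !mulr_ge0 ?(ltW D0)//.
rewrite -cardE cardsT card_ord.
have Dnm : D1 <= n%:R * (m%:R * D1).
  by rewrite mulrA ler_peMl ?(ltW D10)// mulr_ege1.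
rewrite [leRHS](_ : _ = 20 * (n%:R * (m%:R * D1))); last by rewrite /D1; ring.
lra.
Qed.

End averaging.

(** * Counting index tuples *)

Section increasing_indices_count.
Local Open Scope set_scope.
Variables n r : nat.
Implicit Types (t : r.-tuple 'I_n) (B : {set 'I_n}).

Let support t : {set 'I_n} := [set i in t].

Lemma tnth_increasing_inj t : t \in increasing_indices n r -> injective (tnth t).
Proof.
rewrite inE => st; apply/tuple_uniqP; rewrite -(map_inj_uniq val_inj).
exact: sorted_uniq ltn_trans ltnn _ st.
Qed.

Let card_support t : t \in increasing_indices n r -> #|support t| = r.
Proof.
move=> /tnth_increasing_inj/tuple_uniqP ut.
by rewrite cardsE (card_uniqP ut) size_tuple.
Qed.

Let support_inj : {in increasing_indices n r &, injective support}.
Proof.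
move=> t t'; rewrite !inE => st st' tt'; apply/val_inj/(inj_map val_inj).
apply: (irr_sorted_eq ltn_trans ltnn st st') => k.
by apply/mapP/mapP => -[i it ->]; exists i => //;
  move/setP: tt' => /(_ i); rewrite !inE it.
Qed.

Let imset_support : support @: increasing_indices n r = [set A : {set 'I_n} | #|A| == r].
Proof.
apply/eqP; rewrite eqEcard; apply/andP; split.
  by apply/fintype.subsetP => _ /imsetP[t tI ->]; rewrite inE card_support.
by rewrite card_in_imset// card_ltn_sorted_tuples card_draws card_ord.
Qed.

(** Increasing tuples are the same as sets of cardinal [r], and the sets that
    contain [B] are obtained from subsets of the complement of [B]. *)
Lemma card_increasing_containing B : (#|B| <= r)%N ->
  #|[set t in increasing_indices n r | B \subset [set i in t]]| =
  'C(n - #|B|, r - #|B|).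
Proof.
move=> Br.
have -> : #|[set t in increasing_indices n r | B \subset [set i in t]]| =
    #|[set A : {set 'I_n} | (#|A| == r) && (B \subset A)]|.
  rewrite -(card_in_imset (f := support)); last first.
    by move=> t t'; rewrite !inE => /andP[tI _] /andP[t'I _]; apply: support_inj; rewrite inE.
  apply: eq_card => A; rewrite inE; apply/imsetP/andP.
    move=> [t]; rewrite inE => /andP[tI Bt] ->; split=> //.
    by rewrite card_support.
  move=> [Ar BA]; have : A \in support @: increasing_indices n r by rewrite imset_support inE.
  by move=> /imsetP[t tI AE]; exists t; rewrite // inE tI -/(support t) -AE.
have -> : (n - #|B| = #|~: B|)%N by rewrite -[RHS](addKn #|B|) cardsC card_ord.
rewrite -cards_draws; set D := [set A | _ & _].
rewrite -[RHS](card_in_imset (f := fun A => A :|: B)).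
  apply: eq_card => A; rewrite inE; apply/andP/imsetP.
    move=> [/eqP Ar BA]; exists (A :\: B).
      rewrite inE cardsD (finset.setIidPr BA) Ar eqxx andbT.
      by apply/fintype.subsetP => i; rewrite !inE => /andP[].
    apply/setP => i; rewrite !inE.
    by case: (boolP (i \in B)) => [/(fintype.subsetP BA) ->|_]; rewrite ?orbT ?orbF.
  move=> [A']; rewrite inE => /andP[/fintype.subsetP A'B /eqP A'r] ->.
  split; last exact: finset.subsetUr.
  rewrite cardsU A'r (_ : A' :&: B = finset.set0) ?cards0 ?subn0 ?subnK//.
  by apply/setP => i; rewrite !inE; apply/negP => /andP[/A'B]; rewrite inE => /negP.
move=> A A'; rewrite !inE => /andP[/fintype.subsetP AB _] /andP[/fintype.subsetP A'B _] /setP AA'.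
apply/setP => i; have := AA' i; have := AB i; have := A'B i; rewrite !inE.
by case: (i \in B) => //=; rewrite ?orbT ?orbF// => h1 h2 _; apply/idP/idP => [/h2|/h1].
Qed.

Lemma card_increasing : #|increasing_indices n r| = 'C(n, r).
Proof. exact: card_ltn_sorted_tuples. Qed.

Lemma card_increasing1 (i : 'I_n) : (0 < r)%N ->
  (n * #|[set t in increasing_indices n r | i \in t]| =
   r * #|increasing_indices n r|)%N.
Proof.
move=> r0; have := @card_increasing_containing [set i]%SET.
rewrite cards1 => /(_ r0) h.
have -> : [set t in increasing_indices n r | i \in t] =
    [set t in increasing_indices n r | [set i]%SET \subset [set j in t]].
  by apply/setP => t; rewrite !inE finset.sub1set inE.
by rewrite h !subn1 mul_bin_diag prednK// card_increasing.
Qed.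

Lemma card_increasing2 (i j : 'I_n) : (1 < r)%N -> i != j ->
  (n * n.-1 * #|[set t in increasing_indices n r | (i \in t) && (j \in t)]| =
   r * r.-1 * #|increasing_indices n r|)%N.
Proof.
move=> r1 ij; have := @card_increasing_containing [set i; j]%SET.
rewrite cards2 ij => /(_ r1) h.
have -> : [set t in increasing_indices n r | (i \in t) && (j \in t)] =
    [set t in increasing_indices n r | [set i; j]%SET \subset [set k in t]].
  by apply/setP => t; rewrite !inE finset.subUset !finset.sub1set !inE.
rewrite h card_increasing -mulnA.
have -> : (n - 2 = n.-1.-1)%N by rewrite -!subn1 -subnDA.
case: r r1 => [|[|r']]// _; rewrite !subSS subn0 mul_bin_diag.
by rewrite mulnCA mul_bin_diag mulnA [(r'.+1 * _)%N]mulnC.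
Qed.

End increasing_indices_count.

(** * The second-order part of a U-statistic with a bounded kernel *)

Section kernel_law.
Context (dO dS : measure_display) (Omega : measurableType dO)
  (S : measurableType dS) (R : realType) (P : probability Omega R) (n : nat).
Variables (X : 'I_n -> {RV P >-> S}) (iidX : iid X) (i0 : 'I_n).

(** The index map [t] says which variables fill the coordinates in [B], so that
    samples taken along different index tuples can be compared. *)
Definition mixed_sample m (t : 'I_m -> 'I_n) (B : {set 'I_m}) (y : m.-tuple S)
  (w : Omega) : m.-tuple S :=
  [tuple if k \in B then X (t k) w else tnth y k | k < m].

Lemma measurable_mixed_sample m (t : 'I_m -> 'I_n) B y :
  measurable_fun setT (mixed_sample t B y).
Proof.
apply/measurable_fun_tnthP => k; have [kB|kB] := boolP (k \in B).
  apply: eq_measurable_fun (measurable_funP (X (t k))).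
  by move=> w _ /=; rewrite tnth_mktuple kB.
apply: (@eq_measurable_fun _ _ _ _ _ (fun=> tnth y k)) => //.
by move=> w _ /=; rewrite tnth_mktuple (negbTE kB).
Qed.

(** Independence and identical distribution make the choice of distinct indices
    irrelevant. *)
Lemma mixed_sample_box m (t t' : 'I_m -> 'I_n) (B : {set 'I_m}) (y : m.-tuple S) :
  {in B &, injective t} -> {in B &, injective t'} ->
  forall A : 'I_m -> set S, (forall k, measurable (A k)) ->
  P (mixed_sample t B y @^-1` box A) = P (mixed_sample t' B y @^-1` box A).
Proof.
move=> tI t'I A mA.
have E u : mixed_sample u B y @^-1` box A =
    [set w | forall k, A k (if k \in B then X (u k) w else tnth y k)].
  by apply/seteqP; split=> w h k; have := h k; rewrite !tnth_mktuple.
by rewrite !E !(prob_mixed_box iidX i0).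
Qed.

End kernel_law.

Section kernel_parts.
Context (dO dS : measure_display) (Omega : measurableType dO)
  (S : measurableType dS) (R : realType) (P : probability Omega R) (n r : nat).
Variables (X : 'I_n -> {RV P >-> S}) (le_rn : (r <= n)%N).
Variable f : r.-tuple S -> R.

Definition subtuple (t : r.-tuple 'I_n) (x : n.-tuple S) : r.-tuple S :=
  [tuple tnth x (tnth t k) | k < r].

Definition kernel_mean : R := mean X (f \o subtuple (first_indices le_rn)).

Definition kernel_projection (x : S) : R :=
  \int[P]_w f [tuple if val k == 0%N then x else X (widen_ord le_rn k) w | k < r].

Definition kernel_average (x : n.-tuple S) : R :=
  (#|increasing_indices n r|%:R)^-1 *
    \sum_(t in increasing_indices n r) f (subtuple t x).

(** This is the sum of the terms of order at least two in the Hoeffding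
    decomposition of the U-statistic. *)
Definition second_order_part (x : n.-tuple S) : R :=
  (kernel_average x - kernel_mean) -
  r%:R / n%:R * \sum_(i < n) (kernel_projection (tnth x i) - kernel_mean).

Lemma measurable_subtuple t : measurable_fun setT (subtuple t).
Proof.
apply/measurable_fun_tnthP => k; apply: eq_measurable_fun (@measurable_tnth _ S n (tnth t k)).
by move=> x _ /=; rewrite tnth_mktuple.
Qed.

Lemma measurable_projection_args2 : measurable_fun setT (fun p : S * Omega =>
  [tuple if val k == 0%N then p.1 else X (widen_ord le_rn k) p.2 | k < r]).
Proof.
apply/measurable_fun_tnthP => k; have [kB|kB] := boolP (val k == 0%N).
  apply: (@eq_measurable_fun _ _ _ _ _ fst) => //.
  by move=> w _ /=; rewrite tnth_mktuple kB.
apply: (@eq_measurable_fun _ _ _ _ _ (X (widen_ord le_rn k) \o snd)).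
  by move=> w _ /=; rewrite tnth_mktuple (negbTE kB).
exact: measurableT_comp.
Qed.

Lemma measurable_projection_args x : measurable_fun setT (fun w =>
  [tuple if val k == 0%N then x else X (widen_ord le_rn k) w | k < r]).
Proof. exact: measurableT_comp measurable_projection_args2 (measurable_pair1 x). Qed.

Hypothesis mf : measurable_fun [set: r.-tuple S] f.

Lemma measurable_kernel_projection : measurable_fun setT kernel_projection.
Proof.
apply: (@measurable_fun_parametric_integral _ _ _ _ _ P (fun p => f
  [tuple if val k == 0%N then p.1 else X (widen_ord le_rn k) p.2 | k < r])).
exact: measurableT_comp mf measurable_projection_args2.
Qed.

Lemma measurable_second_order_part : measurable_fun [set: n.-tuple S] second_order_part.
Proof.
apply: measurable_funB; last first.
  apply: measurable_funM => //; apply: measurable_sum => i.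
  apply: measurable_funB => //.
  exact: measurableT_comp measurable_kernel_projection (@measurable_tnth _ S n i).
apply: measurable_funB => //; apply: measurable_funM => //.
under eq_fun do rewrite big_mkcond/=.
apply: measurable_sum => t; case: (t \in _) => //.
exact: measurableT_comp mf (measurable_subtuple t).
Qed.

End kernel_parts.

Section kernel.
Context (dO dS : measure_display) (Omega : measurableType dO)
  (S : measurableType dS) (R : realType) (P : probability Omega R) (n r : nat).
Variables (X : 'I_n -> {RV P >-> S}) (iidX : iid X) (le_rn : (r <= n)%N)
  (k0 : 'I_r).
Variable f : r.-tuple S -> R.
Hypotheses (bf : bounded_measurable f)
  (fsym : forall (s : 'S_r) x, f [tuple tnth x (s k) | k < r] = f x).
Hypothesis k00 : val k0 = 0%N.

Let i0 : 'I_n := widen_ord le_rn k0.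
Local Notation average := (average X).
Local Notation mean := (mean X).

Local Notation subtuple := (@subtuple dS S n r).
Local Notation kernel_mean := (kernel_mean X le_rn f).
Local Notation kernel_projection := (kernel_projection X le_rn f).
Local Notation kernel_average := (@kernel_average dS S R n r f).
Local Notation second_order_part := (second_order_part X le_rn f).

Lemma tnth_first_indices k : tnth (first_indices le_rn) k = widen_ord le_rn k.
Proof. by rewrite tnth_mktuple. Qed.

Lemma widen_ord_inj : injective (widen_ord le_rn).
Proof. by move=> k l /(congr1 val)/= kl; exact/val_inj. Qed.

Lemma bounded_measurable_subtuple t : bounded_measurable (f \o subtuple t).
Proof. exact: bounded_measurable_comp (measurable_subtuple t) bf. Qed.

Lemma mean_subtuple t (F : r.-tuple S -> R) : measurable_fun [set: r.-tuple S] F ->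
  injective (tnth t) -> mean (F \o subtuple t) = mean (F \o subtuple (first_indices le_rn)).
Proof.
move=> mF tI.
have E u x : subtuple u (sample X x) =
    mixed_sample X (tnth u) [set: 'I_r]%SET [tuple point | _ < r] x.
  by apply: eq_from_tnth => k; rewrite !tnth_mktuple inE.
rewrite /mean /=; under eq_Rintegral do rewrite E.
under [RHS]eq_Rintegral do rewrite E.
apply: eq_Rintegral_law => //; try exact: measurable_mixed_sample.
apply: (mixed_sample_box iidX i0); first by move=> k l _ _ /tI.
by move=> k l _ _; rewrite !tnth_first_indices; exact: widen_ord_inj.
Qed.

Lemma average_subtuple_out t (k : 'I_n) x : injective (tnth t) -> k \notin t ->
  average (~: [set k])%SET (f \o subtuple t) x = kernel_mean.
Proof.
move=> tI kt; rewrite /kernel_mean -(mean_subtuple _ tI); last by case: bf.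
apply: eq_Rintegral => w _ /=; congr f; apply: eq_from_tnth => l.
rewrite !tnth_mktuple !inE; case: eqP => // tlk.
by case/negP: kt; rewrite -tlk mem_tnth.
Qed.

(** By symmetry of [f], the frozen argument can be moved from position [a] to the
    first position, where [kernel_projection] expects it. *)
Lemma average_subtuple_in t (a : 'I_r) x : injective (tnth t) ->
  average (~: [set tnth t a])%SET (f \o subtuple t) x =
  kernel_projection (tnth x (tnth t a)).
Proof.
move=> tI; set y : r.-tuple S := [tuple tnth x (tnth t a) | _ < r].
transitivity (\int[P]_w f (mixed_sample X (fun k => tnth t (tperm a k0 k))
    (~: [set k0])%SET y w)).
  apply: eq_Rintegral => w _ /=; rewrite -(fsym (tperm a k0)); congr f.
  apply: eq_from_tnth => l; rewrite !tnth_mktuple !inE (inj_eq tI).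
  rewrite -[X in _ == X](tpermR a k0) (inj_eq perm_inj).
  by case: eqP => //= ->; rewrite tpermR.
transitivity (\int[P]_w f (mixed_sample X (widen_ord le_rn) (~: [set k0])%SET y w)).
  apply: eq_Rintegral_law; try exact: measurable_mixed_sample; last by case: bf.
  apply: (mixed_sample_box iidX i0); last by move=> k l _ _ /widen_ord_inj.
  by move=> k l _ _ /tI/perm_inj.
apply: eq_Rintegral => w _; congr f; apply: eq_from_tnth => l.
by rewrite !tnth_mktuple !inE -val_eqE/= k00; case: eqP.
Qed.

Lemma bounded_measurable_kernel_projection : bounded_measurable kernel_projection.
Proof.
have [mf [M fM]] := bf; split; first exact: measurable_kernel_projection.
exists M => x; apply: Rintegral_norm_le => //.
exact: measurableT_comp mf (measurable_projection_args X le_rn x).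
Qed.

Lemma bounded_measurable_projection_tnth i :
  bounded_measurable (fun x : n.-tuple S => kernel_projection (tnth x i)).
Proof.
exact: (bounded_measurable_comp (@measurable_tnth _ S n i) bounded_measurable_kernel_projection).
Qed.

(** Such a tuple is not increasing in general; the average and mean lemmas above
    only require its entries to be distinct. *)
Let indices_through (i : 'I_n) : {t : r.-tuple 'I_n | injective (tnth t) & tnth t k0 = i}.
Proof.
exists [tuple tperm i i0 (widen_ord le_rn k) | k < r].
  by move=> k l; rewrite !tnth_mktuple => /perm_inj/widen_ord_inj.
by rewrite tnth_mktuple tpermR.
Qed.

Lemma mean_projection i :
  mean (fun x : n.-tuple S => kernel_projection (tnth x i)) = kernel_mean.
Proof.
have [t tI <-] := indices_through i.
under eq_fun do rewrite -average_subtuple_in//.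
rewrite (mean_average iidX i0); last exact: bounded_measurable_subtuple.
by apply: mean_subtuple => //; case: bf.
Qed.

Lemma bounded_measurable_second_order_part : bounded_measurable second_order_part.
Proof.
apply: bounded_measurableB; last first.
  apply: bounded_measurableZ; apply: bounded_measurable_sum => i.
  apply: bounded_measurableB; last exact: bounded_measurable_cst.
  exact: bounded_measurable_projection_tnth.
apply: bounded_measurableB; last exact: bounded_measurable_cst.
apply: bounded_measurableZ; apply: bounded_measurable_sum => t.
exact: bounded_measurable_subtuple.
Qed.

Let c : R := r%:R / n%:R.

Lemma average_second_order_partE B x : average B second_order_part x =
  ((#|increasing_indices n r|%:R)^-1 *
    (\sum_(t in increasing_indices n r) average B (f \o subtuple t) x) - kernel_mean) -
  c * \sum_(i < n) (average B (fun z => kernel_projection (tnth z i)) x - kernel_mean).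
Proof.
have bK : bounded_measurable (fun z : n.-tuple S => kernel_mean).
  exact: bounded_measurable_cst.
have bs t : bounded_measurable (f \o subtuple t) by exact: bounded_measurable_subtuple.
have bg i : bounded_measurable (fun z : n.-tuple S => kernel_projection (tnth z i) - kernel_mean).
  by apply: bounded_measurableB => //; exact: bounded_measurable_projection_tnth.
have aK : average B (fun z : n.-tuple S => kernel_mean) x = kernel_mean.
  by rewrite average_avoids.
have bS : bounded_measurable (fun z : n.-tuple S =>
    \sum_(t in increasing_indices n r) (f \o subtuple t) z).
  exact: bounded_measurable_sum.
have bG : bounded_measurable (fun z : n.-tuple S =>
    \sum_(i < n) (kernel_projection (tnth z i) - kernel_mean)).
  exact: bounded_measurable_sum.
have bU : bounded_measurable kernel_average.
  exact: (bounded_measurableZ (#|increasing_indices n r|%:R^-1) bS).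
rewrite /second_order_part averageB; [|exact: bounded_measurableB|exact: bounded_measurableZ].
rewrite averageB// aK averageZ// averageZ// average_sum// average_sum//.
congr (_ - _ * _); apply: eq_bigr => i _; rewrite averageB ?aK//.
exact: bounded_measurable_projection_tnth.
Qed.

(** The U-statistic averages to [theta + (r / n) (g (x_k) - theta)], since a
    proportion [r / n] of the index tuples contain [k] ([card_increasing1]);
    this is what the linear part averages to. *)
Lemma average_second_order_part_eq0 (k : 'I_n) x :
  average (~: [set k])%SET second_order_part x = 0.
Proof.
have r0 : (0 < r)%N by case: (r) k0 => [[]|].
have n0 : (0 < n)%N by apply: leq_trans le_rn.
have nN : n%:R != 0 :> R by rewrite pnatr_eq0 -lt0n.
rewrite average_second_order_partE.
pose I := increasing_indices n r.
have IN : #|I|%:R != 0 :> R by rewrite pnatr_eq0 card_increasing -lt0n bin_gt0.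
set gx := kernel_projection (tnth x k); set th := kernel_mean.
have -> : \sum_(t in I) average (~: [set k])%SET (f \o subtuple t) x =
    #|I|%:R * th + c * #|I|%:R * (gx - th).
  transitivity (\sum_(t in I) (th + (k \in t)%:R * (gx - th))).
    apply: eq_bigr => t /tnth_increasing_inj tI.
    have [/tnthP[a ka]|kt] := boolP (k \in t).
      by rewrite mul1r addrC subrK /gx ka; exact: average_subtuple_in.
    by rewrite average_subtuple_out// mul0r addr0.
  rewrite big_split/= sumr_const -mulr_suml -[th *+ _]mulr_natl; congr (_ + _ * _).
  have -> : \sum_(t in I) (k \in t)%:R = #|[set t in I | k \in t]%SET|%:R :> R.
    rewrite -sum1_card natr_sum big_mkcond [RHS]big_mkcond/=.
    apply: eq_bigr => t _; rewrite [X in _ = if X then _ else _]inE -/I.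
    by case: (t \in I); case: (k \in t).
  apply: (mulfI nN); rewrite -natrM card_increasing1// natrM /c mulrA mulrCA.
  by rewrite divff// mulr1.
have -> : \sum_(i < n) (average (~: [set k])%SET (fun z => kernel_projection (tnth z i)) x - th) =
    gx - th.
  rewrite (bigD1 k)//= [X in _ + X]big1 ?addr0.
    rewrite average_avoids// => y z; congr kernel_projection.
    by rewrite tnth_mktuple !inE eqxx.
  move=> i ik; apply/eqP; rewrite subr_eq0 /th -(mean_projection i); apply/eqP.
  by apply: eq_Rintegral => w _; rewrite tnth_mktuple !inE ik.
rewrite -/I; set N : R := #|I|%:R in IN *; set e := gx - th.
clearbody N c e; by field.
Qed.

Lemma avoids_subtuple (i : 'I_n) t : i \notin t -> avoids [set i]%SET (f \o subtuple t).
Proof.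
move=> it y x /=; congr f; apply: eq_from_tnth => k; rewrite !tnth_mktuple !inE.
by case: eqP => // tk; case/negP: it; rewrite -tk mem_tnth.
Qed.

(** [increment i] keeps only the summands that depend on the coordinate [i]; a
    second increment in another coordinate then removes the linear part. *)
Lemma increment2_second_order_partE (i j : 'I_n) x : i != j ->
  increment X j (increment X i second_order_part) x =
  (#|increasing_indices n r|%:R)^-1 *
    \sum_(t in [set t in increasing_indices n r | (i \in t) && (j \in t)]%SET)
      increment X j (increment X i (f \o subtuple t)) x.
Proof.
move=> ij.
have bs t : bounded_measurable (f \o subtuple t) by exact: bounded_measurable_subtuple.
have bg l : bounded_measurable (fun z : n.-tuple S => kernel_projection (tnth z l)).
  exact: bounded_measurable_projection_tnth.
have bi t : bounded_measurable (increment X i (f \o subtuple t)).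
  exact: bounded_measurable_increment.
pose H z := (#|increasing_indices n r|%:R)^-1 *
    \sum_(t in increasing_indices n r) increment X i (f \o subtuple t) z -
    c * increment X i (fun z => kernel_projection (tnth z i)) z.
rewrite (@eq_increment _ _ _ _ _ _ _ X j _ H); last first.
  move=> z; rewrite {1}/increment average_second_order_partE /second_order_part.
  rewrite /H /kernel_average -/c.
  have -> : increment X i (fun z => kernel_projection (tnth z i)) z =
      \sum_(l < n) (kernel_projection (tnth z l) - kernel_mean) -
      \sum_(l < n) (average [set i]%SET (fun z => kernel_projection (tnth z l)) z - kernel_mean).
    rewrite -sumrB (bigD1 i)//= big1 ?addr0 => [|l li]; first by rewrite opprB addrA subrK.
    rewrite average_avoids ?subrr// => y x'; congr kernel_projection.
    by rewrite tnth_mktuple inE (negbTE li).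
  by rewrite [X in _ = _ * X - _]sumrB; ring.
have bgi := bounded_measurable_increment X i (bg i).
have bSi := bounded_measurable_sum (index_enum _) (mem (increasing_indices n r)) bi.
rewrite {1}/increment {1}/H /H averageB; last 2 first.
- exact: bounded_measurableZ.
- exact: bounded_measurableZ.
rewrite averageZ// averageZ//.
rewrite average_sum//.
rewrite [average _ (increment X i (fun z => kernel_projection (tnth z i))) x]
  average_avoids; last first.
  apply: avoids_increment => y z; congr kernel_projection.
  by rewrite tnth_mktuple inE (negbTE ij).
rewrite opprB addrA subrK -mulrBr -sumrB; congr (_ * _).
rewrite (bigID (fun t => (i \in t) && (j \in t)))/= [X in _ + X]big1 ?addr0.
  by apply: eq_bigl => t; rewrite !inE.
move=> t /andP[_]; rewrite negb_and => /orP[it|jt].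
  have i0t z : increment X i (f \o subtuple t) z = 0.
    by apply: increment_avoids; exact: avoids_subtuple.
  rewrite -[LHS]/(increment X j (increment X i (f \o subtuple t)) x).
  rewrite (@eq_increment _ _ _ _ _ _ _ X j _ (fun=> 0))//.
  by apply: increment_avoids.
rewrite -[LHS]/(increment X j (increment X i (f \o subtuple t)) x).
by apply: increment_avoids; apply: avoids_increment; exact: avoids_subtuple.
Qed.

(** Write [q] for the proportion of index tuples through [i] and [j].  The iterated
    increment is [q] times an average of terms with norm at most 4 times that of
    the kernel, which gives the factor [16 q ^ 2] on squared norms, and
    [n q <= r ^ 2 / n]. *)
Lemma second_order_part_moment m (V : R) : (1 < r)%N -> (0 < m)%N -> 0 < V ->
  mean (fun x => f (subtuple (first_indices le_rn) x) ^+ (2 * m)) <= V ^+ m ->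
  mean (fun x => second_order_part x ^+ (2 * m)) <=
    (3200 * m%:R ^+ 2 * (r%:R ^+ 2 / n%:R) ^+ 2 * V) ^+ m.
Proof.
move=> r1 m0 V0 fV.
have p0 : (0 < 2 * m)%N by rewrite muln_gt0.
have n1 : (1 < n)%N by apply: leq_trans le_rn.
pose N : R := #|increasing_indices n r|%:R.
have N0 : 0 < N by rewrite ltr0n card_increasing bin_gt0.
have rR : 1 < r%:R :> R by rewrite ltr1n.
have nR : 1 < n%:R :> R by rewrite ltr1n.
have rnR : r%:R <= n%:R :> R by rewrite ler_nat.
pose q : R := r%:R * (r%:R - 1) / (n%:R * (n%:R - 1)).
have q0 : 0 < q by rewrite divr_gt0// mulr_gt0 ?subr_gt0//; lra.
have nz1 : n%:R != 0 :> R by rewrite gt_eqF//; lra.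
have nz2 : n%:R - 1 != 0 :> R by rewrite gt_eqF//; lra.
have D0 : 0 < 16 * q ^+ 2 * V by rewrite mulr_gt0// mulr_gt0 ?exprn_gt0// ltr0n.
have bT := bounded_measurable_second_order_part.
apply: le_trans (_ : (200 * m%:R ^+ 2 * n%:R ^+ 2 * (16 * q ^+ 2 * V)) ^+ m <= _).
  apply: (second_order_moment iidX i0 m0 bT) => //.
  - by move=> k x; exact: average_second_order_part_eq0.
  move=> i j ij.
  pose Iij := [set t in increasing_indices n r | (i \in t) && (j \in t)]%SET.
  have qE : #|Iij|%:R = N * q.
    have := card_increasing2 r1 ij; rewrite -/Iij => /(congr1 (fun k => k%:R : R)).
    rewrite !natrM -/N -!subn1 !natrB ?(ltnW n1) ?(ltnW r1)// => h.
    apply: (mulfI (x := n%:R * (n%:R - 1))); first by rewrite mulf_neq0.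
    by rewrite h /q; field; rewrite nz1 nz2.
  pose a t := increment X j (increment X i (f \o subtuple t)).
  have ba t : bounded_measurable (a t).
    by do 2 apply: bounded_measurable_increment; exact: bounded_measurable_subtuple.
  have bX h k : bounded_measurable h -> bounded_measurable (fun z : n.-tuple S => h z ^+ k : R).
    exact: bounded_measurableX.
  have aV t : injective (tnth t) -> mean (fun z => a t z ^+ (2 * m)) <= 16 ^+ m * V ^+ m.
    move=> tI; have bs := bounded_measurable_subtuple t.
    apply: (le_trans (increment_contracts iidX i0 _ _ _)) => //.
      exact: bounded_measurable_increment.
    rewrite (_ : 16 ^+ m = 4 ^+ m * 4 ^+ m); last first.
      by rewrite -exprMn; congr (_ ^+ _); ring.
    rewrite -mulrA ler_wpM2l ?exprn_ge0//.
    apply: (le_trans (increment_contracts iidX i0 _ _ _)) => //.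
    rewrite ler_wpM2l ?exprn_ge0//; apply: le_trans fV.
    rewrite le_eqVlt; apply/orP; left; apply/eqP.
    apply: (mean_subtuple (F := fun y => f y ^+ (2 * m))) => //.
    by apply: measurable_funX; case: bf.
  rewrite (@eq_mean _ _ _ _ _ _ _ X _
    (fun z => (N^-1 * \sum_(t in Iij) a t z) ^+ (2 * m))); last first.
    by move=> z; rewrite increment2_second_order_partE.
  apply: (@le_trans _ _ (mean (fun z => N^-1 ^+ (2 * m) * (#|Iij|%:R ^+ (2 * m).-1 *
     \sum_(t in Iij) a t z ^+ (2 * m))))).
    apply: mean_le.
    - by apply: (bX); apply: bounded_measurableZ; exact: bounded_measurable_sum.
    - by do 2 apply: bounded_measurableZ; apply: bounded_measurable_sum => t; exact: bX.
    move=> z; rewrite exprMn ler_wpM2l ?exprn_ge0 ?invr_ge0 ?(ltW N0)//.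
    exact: pow_sum_le.
  have bS : bounded_measurable (fun z => \sum_(t in Iij) a t z ^+ (2 * m)).
    by apply: bounded_measurable_sum => t; exact: bX.
  rewrite meanZ; last exact: bounded_measurableZ.
  rewrite meanZ//.
  have -> : mean (fun z => \sum_(t in Iij) a t z ^+ (2 * m)) =
      \sum_(t in Iij) mean (fun z => a t z ^+ (2 * m)).
    rewrite (mean_averageT X _ (sample X point)) average_sum; last by move=> t; exact: bX.
    by apply: eq_bigr => t _; rewrite -mean_averageT.
  apply: (@le_trans _ _ (N^-1 ^+ (2 * m) * (#|Iij|%:R ^+ (2 * m).-1 *
      \sum_(t in Iij) (16 ^+ m * V ^+ m)))).
    rewrite ler_wpM2l ?exprn_ge0 ?invr_ge0 ?(ltW N0)// ler_wpM2l ?exprn_ge0//.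
    apply: ler_sum => t; rewrite inE => /andP[/tnth_increasing_inj tI _].
    exact: aV.
  rewrite sumr_const -[(_ * _) *+ _]mulr_natl [X in _ * X <= _]mulrA -exprSr prednK//.
  rewrite [leLHS]mulrA -[X in X * _]exprMn qE mulKf ?gt_eqF// exprM -!exprMn.
  by rewrite mulrCA mulrA.
have -> : 3200 * m%:R ^+ 2 * (r%:R ^+ 2 / n%:R) ^+ 2 * V =
    200 * m%:R ^+ 2 * (16 * V * (r%:R ^+ 2 / n%:R) ^+ 2) by ring.
have -> : 200 * m%:R ^+ 2 * n%:R ^+ 2 * (16 * q ^+ 2 * V) =
    200 * m%:R ^+ 2 * (16 * V * (n%:R * q) ^+ 2) by ring.
have : 0 <= 200 * m%:R ^+ 2 :> R by rewrite mulr_ge0 ?exprn_ge0.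
have : 0 <= 16 * V by rewrite mulr_ge0 ?(ltW V0).
move: (16 * V) (200 * m%:R ^+ 2) => v k v0 k0'.
have nq0 : 0 <= n%:R * q by rewrite mulr_ge0 ?(ltW q0).
have rn0 : 0 <= r%:R ^+ 2 / n%:R :> R by rewrite divr_ge0 ?exprn_ge0.
have nqr : n%:R * q <= r%:R ^+ 2 / n%:R.
  have -> : n%:R * q = r%:R * (r%:R - 1) / (n%:R - 1) by rewrite /q; field; rewrite nz1 nz2.
  rewrite ler_pdivrMr; last lra.
  rewrite mulrAC ler_pdivlMr; last lra.
  by rewrite expr2 -!mulrA ler_wpM2l//; nra.
apply: lerXn2r; rewrite ?nnegrE.
- by do 2 rewrite mulr_ge0//; rewrite exprn_ge0.
- by do 2 rewrite mulr_ge0//; rewrite exprn_ge0.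
do 2 apply: ler_wpM2l => //.
by apply: lerXn2r; rewrite ?nnegrE.
Qed.

End kernel.

(** * Unbounded kernels by clamping *)

Section clamp.
Variable R : realType.
Implicit Types (y : R) (N : nat).

Definition clamp N y : R := Num.max (- N%:R) (Num.min N%:R y).

Lemma clamp_le N y : `|clamp N y| <= N%:R.
Proof.
have N0 : 0 <= N%:R :> R by [].
by rewrite ler_norml /clamp le_max lexx ge_max ge_min lexx andbT; lra.
Qed.

Lemma clamp_norm_le N y : `|clamp N y| <= `|y|.
Proof.
have N0 : 0 <= N%:R :> R by [].
by rewrite ler_norml /clamp; case: (ger0P y) => y0; rewrite maxEle minEle;
  do 2 case: ifPn; rewrite -?ltNge => *; apply/andP; split; lra.
Qed.

Lemma clamp_id N y : `|y| <= N%:R -> clamp N y = y.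
Proof.
rewrite ler_norml => /andP[Ny yN]; rewrite /clamp.
by rewrite (min_idPr yN) (max_idPr Ny).
Qed.

(** The sequence is eventually constant. *)
Lemma cvg_clamp y : clamp N y @[N --> \oo] --> y.
Proof.
apply: cvg_near_cst; exists (Num.truncn `|y|).+1 => // N /= yN; apply: clamp_id.
by rewrite ltW// (lt_le_trans (truncnS_gt _))// ler_nat.
Qed.

Lemma measurable_clamp N (d : measure_display) (T : measurableType d) (f : T -> R) :
  measurable_fun setT f -> measurable_fun setT (fun x => clamp N (f x)).
Proof.
move=> mf; apply: measurable_maxr => //.
exact: measurable_minr.
Qed.

Lemma cvg_Rintegral_clamp (d : measure_display) (T : measurableType d)
    (P : probability T R) (f : T -> R) : P.-integrable setT (EFin \o f) ->
  \int[P]_w clamp N (f w) @[N --> \oo] --> \int[P]_w f w.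
Proof.
move=> fi; have mf : measurable_fun setT f.
  by case/integrableP : fi => /measurable_EFinP.
have mN N : measurable_fun setT (fun w => (clamp N (f w))%:E).
  exact/measurable_EFinP/measurable_clamp.
have mE : measurable_fun setT (EFin \o f) by exact/measurable_EFinP.
have cE w : (clamp N (f w))%:E @[N --> \oo] --> (EFin \o f) w.
  by apply: cvg_EFin; [exact: nearW|exact: cvg_clamp].
have le w N : setT w -> (`|(clamp N (f w))%:E| <= (abse \o (EFin \o f)) w)%E.
  by move=> _; rewrite /= lee_fin clamp_norm_le.
have [_ _] := dominated_convergence measurableT mN mE (aeW _ (fun w _ => cE w))
  (integrable_abse fi) (aeW _ le).
rewrite -[X in _ --> X -> _]fineK; last exact: integrable_fin_num.
by move=> /fine_cvg.
Qed.

End clamp.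

Section unbounded_kernel.
Context (dO dS : measure_display) (Omega : measurableType dO)
  (S : measurableType dS) (R : realType) (P : probability Omega R) (n r : nat).
Variables (X : 'I_n -> {RV P >-> S}) (iidX : iid X) (le_rn : (r <= n)%N)
  (k0 : 'I_r).
Variable f : r.-tuple S -> R.
Hypotheses (mf : measurable_fun [set: r.-tuple S] f)
  (fsym : forall (s : 'S_r) x, f [tuple tnth x (s k) | k < r] = f x).
Hypothesis k00 : val k0 = 0%N.

Local Notation first := (first_indices le_rn).
Local Notation first_sample w := (subtuple first (sample X w)).
Local Notation args x w :=
  [tuple if val k == 0%N then x else X (widen_ord le_rn k) w | k < r].

Hypothesis fint : P.-integrable setT (fun w => (f (first_sample w))%:E).

Let i0 : 'I_n := widen_ord le_rn k0.

Lemma projection_args_box (i : 'I_n) (A : 'I_r -> set S) :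
  (forall k, measurable (A k)) ->
  (P \x P)%E ((fun z : Omega * Omega => args (X i z.1) z.2) @^-1` box A) =
  P ((fun w => first_sample w) @^-1` box A).
Proof.
move=> mA.
pose Z (t : 'I_r -> 'I_n) (B : {set 'I_r}) A' :=
  [set w | forall k, A' k (if k \in B then X (t k) w else point)].
have mZ t B A' : (forall k, measurable (A' k)) -> measurable (Z t B A').
  move=> mA'.
  rewrite (_ : Z t B A' = mixed_sample X t B [tuple point | _ < r] @^-1` box A').
    by rewrite -[X in measurable X]setTI; apply: measurable_mixed_sample => //;
      exact: measurable_box.
  by apply/seteqP; split=> w h k; have := h k; rewrite !tnth_mktuple.
pose A1 k := if k == k0 then A k else setT.
pose A2 k := if k == k0 then setT else A k.
have mA1 k : measurable (A1 k) by rewrite /A1; case: ifP.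
have mA2 k : measurable (A2 k) by rewrite /A2; case: ifP.
have k0E k : (val k == 0%N) = (k == k0) by rewrite -val_eqE/= k00.
have -> : (fun z : Omega * Omega => args (X i z.1) z.2) @^-1` box A =
    Z (fun=> i) [set k0]%SET A1 `*` Z (widen_ord le_rn) (~: [set k0])%SET A2.
  apply/seteqP; split=> -[w w'] /=.
    move=> h; split=> k /=; have := h k; rewrite /A1 /A2 tnth_mktuple !inE k0E.
      by case: ifP.
    by case: ifP.
  move=> [h1 h2] k; have := h1 k; have := h2 k.
  by rewrite /A1 /A2 tnth_mktuple !inE k0E; case: ifP.
transitivity (P (Z (fun=> i) [set k0]%SET A1) *
   P (Z (widen_ord le_rn) (~: [set k0])%SET A2))%E.
  by apply: product_measure1E; exact: mZ.
have -> : (fun w => first_sample w) @^-1` box A = Z (widen_ord le_rn) [set: 'I_r]%SET A.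
  by apply/seteqP; split=> w h k; have := h k; rewrite !tnth_mktuple inE.
have wI : injective (widen_ord le_rn) by exact: widen_ord_inj.
rewrite /Z (prob_mixed_box iidX i0); last 2 first.
- by move=> k l /set1P -> /set1P ->.
- exact: mA1.
rewrite (prob_mixed_box iidX i0); last 2 first.
- by move=> k l _ _ /wI.
- exact: mA2.
rewrite (prob_mixed_box iidX i0); last 2 first.
- by move=> k l _ _ /wI.
- exact: mA.
rewrite -big_split/=; apply: eq_bigr => k _; rewrite !inE /A1 /A2.
by case: eqP => _ /=; rewrite in_setT ?mul1e ?mule1.
Qed.

(** Freezing one argument at a sample point leaves an integrable kernel almost
    surely, by Fubini; outside this event [kernel_projection] may be the default
    value of [fine] and need not be a limit of its clamped versions. *)
Lemma ae_integrable_projection : {ae P, forall w, forall i : 'I_n,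
  P.-integrable setT (fun w' => (f (args (X i w) w'))%:E)}.
Proof.
have aeF := ae_filter_ringOfSetsType P.
apply: filter_forall => i.
pose Y (z : Omega * Omega) := args (X i z.1) z.2.
have mY : measurable_fun setT Y.
  have m2 : measurable_fun setT (fun z : Omega * Omega => (X i z.1, z.2)).
    by apply: measurable_fun_pair => //=; exact: measurableT_comp.
  exact: measurableT_comp (measurable_projection_args2 X le_rn) m2.
have mfirst : measurable_fun setT (fun w => first_sample w).
  exact: measurableT_comp (measurable_subtuple first) (measurable_sample X).
have iF : (P \x P)%E.-integrable setT (EFin \o f \o Y).
  apply/integrableP; split.
    apply: measurableT_comp => //; exact/measurable_EFinP.
  have [_] := integrableP _ _ _ fint; apply: le_lt_trans.
  have mfe : measurable_fun [set: r.-tuple S] (fun x => `|(f x)%:E|%E).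
    by apply: measurableT_comp => //; exact/measurable_EFinP.
  rewrite le_eqVlt; apply/orP; left; apply/eqP.
  apply: (ge0_eq_integral_law (P1 := (P \x P)%E) mY mfirst _ mfe) => // A mA.
  exact: projection_args_box.
exact: (ae_integrable1 iF).
Qed.

Variable c : R.
Let fc N x := clamp N (f x - c).

(** Subtracting a constant from the kernel does not change its second-order part.
    Clamping [f - c] rather than [f] lets the moments of [f - c] control those of
    the clamped kernels; [c] will be the mean. *)
Lemma cvg_second_order_part_clamp : {ae P, forall w,
  second_order_part X le_rn (fc N) (sample X w) @[N --> \oo] -->
  second_order_part X le_rn f (sample X w)}.
Proof.
have aeF := ae_filter_ringOfSetsType P.
apply: filterS ae_integrable_projection => w wint.
have shift (g : Omega -> R) : P.-integrable setT (EFin \o g) ->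
    \int[P]_w clamp N (g w - c) @[N --> \oo] --> \int[P]_w g w - c.
  move=> ig; have ic : P.-integrable setT (EFin \o (fun=> c : R)).
    by apply: bounded_measurable_integrable; exact: bounded_measurable_cst.
  rewrite -[X in _ - X](Rintegral_cstT P) -RintegralB//.
  apply: cvg_Rintegral_clamp.
  rewrite (_ : EFin \o _ = (EFin \o g) \- (EFin \o (fun=> c)))%E; last exact/funext.
  exact: integrableB.
have -> : second_order_part X le_rn f (sample X w) =
   ((#|increasing_indices n r|%:R)^-1 *
    \sum_(t in increasing_indices n r) (f (subtuple t (sample X w)) - c) -
    (kernel_mean X le_rn f - c)) -
   r%:R / n%:R * \sum_(i < n) ((kernel_projection X le_rn f (tnth (sample X w) i) - c)
      - (kernel_mean X le_rn f - c)).
  have IN : #|increasing_indices n r|%:R != 0 :> R.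
    by rewrite pnatr_eq0 card_increasing -lt0n bin_gt0.
  have -> : \sum_(t in increasing_indices n r) (f (subtuple t (sample X w)) - c) =
      \sum_(t in increasing_indices n r) f (subtuple t (sample X w)) -
      #|increasing_indices n r|%:R * c by rewrite sumrB sumr_const mulr_natl.
  rewrite /second_order_part /kernel_average mulrBr mulKf// opprB addrA subrK; congr (_ - _ * _).
  by apply: eq_bigr => i _; rewrite addrA subrK.
have cmean : kernel_mean X le_rn (fc N) @[N --> \oo] --> kernel_mean X le_rn f - c.
  exact: (shift (fun w' => f (first_sample w'))).
have csum (I : finType) (Q : pred I) (F : nat -> I -> R) (l : I -> R) :
    (forall i, F N i @[N --> \oo] --> l i) ->
    \sum_(i | Q i) F N i @[N --> \oo] --> \sum_(i | Q i) l i.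
  move=> Fl; elim: (index_enum I) => [|i s IH].
    by rewrite big_nil; under eq_fun do rewrite big_nil; exact: cvg_cst.
  rewrite big_cons; under eq_fun do rewrite big_cons.
  by case: (Q i) => //; apply: cvgD.
rewrite /second_order_part /kernel_average.
apply: cvgB; last first.
  apply: cvgM; first exact: cvg_cst.
  apply: csum => i; apply: cvgB => //.
  by rewrite tnth_mktuple; apply: (shift (fun w' => f (args (X i w) w'))); exact: wint.
apply: cvgB => //; apply: cvgM; first exact: cvg_cst.
by apply: csum => t; exact: cvg_clamp.
Qed.

Lemma second_order_part_integral_moment m (V : R) :
  (1 < r)%N -> (0 < m)%N -> 0 < V ->
  (\int[P]_w ((f (first_sample w) - c) ^+ (2 * m))%:E <= (V ^+ m)%:E)%E ->
  (\int[P]_w (second_order_part X le_rn f (sample X w) ^+ (2 * m))%:E <=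
    ((3200 * m%:R ^+ 2 * (r%:R ^+ 2 / n%:R) ^+ 2 * V) ^+ m)%:E)%E.
Proof.
move=> r1 m0 V0 fV; move EK : (_ ^+ m in X in (_ <= X)%E) => K.
have mfirst : measurable_fun setT (fun w => first_sample w).
  exact: measurableT_comp (measurable_subtuple first) (measurable_sample X).
have mE (d : measure_display) (T : measurableType d) (h : T -> R) :
    measurable_fun setT h -> measurable_fun setT (fun w => (h w ^+ (2 * m))%:E).
  by move=> mh; apply/measurable_EFinP; exact: measurable_funX.
have bfc N : bounded_measurable (fc N).
  split; last by exists N%:R => x; exact: clamp_le.
  by apply: measurable_clamp; exact: measurable_funB.
have meanE (h : n.-tuple S -> R) : bounded_measurable h ->
    (\int[P]_w (h (sample X w))%:E)%E = (mean X h)%:E.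
  move=> bh; rewrite /mean /Rintegral fineK//; apply: integrable_fin_num => //.
  exact: (bounded_measurable_integrable P (bounded_measurable_sample X bh)).
pose T N w := second_order_part X le_rn (fc N) (sample X w).
have bT N : bounded_measurable (second_order_part X le_rn (fc N)).
  exact: bounded_measurable_second_order_part.
have mT N : measurable_fun setT (fun w => (T N w ^+ (2 * m))%:E).
  apply: mE; case: (bounded_measurable_sample X (bT N)) => h _; exact: h.
have TK N : (\int[P]_w (T N w ^+ (2 * m))%:E <= K%:E)%E.
  have bX := bounded_measurableX (2 * m) (bT N).
  rewrite (meanE _ bX) lee_fin -EK.
  apply: (second_order_part_moment iidX (bfc N) _ k00) => //.
    by move=> s x; rewrite /fc fsym.
  have bfX := bounded_measurableX (2 * m) (bounded_measurable_subtuple (bfc N) first).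
  rewrite -lee_fin -(meanE _ bfX); apply: le_trans fV.
  apply: ge0_le_integral => //.
  - by move=> w _; rewrite lee_fin; exact: even_pow_ge0.
  - by apply: mE; case: (bounded_measurable_sample X (bounded_measurable_subtuple (bfc N) first)).
  - by apply: mE; apply: measurable_funB => //; exact: measurableT_comp mf mfirst.
  move=> w _; rewrite lee_fin -even_pow_norm -[leRHS]even_pow_norm.
  by rewrite lerXn2r ?nnegrE//; exact: clamp_norm_le.
have mlim : measurable_fun setT (fun w => limn_einf (fun N => (T N w ^+ (2 * m))%:E)).
  under eq_fun do rewrite limn_einf_lim.
  apply: (emeasurable_fun_cvg (fun N w => einfs (fun N => (T N w ^+ (2 * m))%:E) N)).
    exact: measurable_fun_einfs.
  by move=> w _; exact: is_cvg_einfs.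
rewrite (@ge0_ae_eq_integral _ _ _ _ _ _
    (fun w => limn_einf (fun N => (T N w ^+ (2 * m))%:E))) //.
- apply: le_trans (fatou _ _ _ _) _ => //.
    by move=> N w _; rewrite lee_fin; exact: even_pow_ge0.
  rewrite limn_einf_lim; apply: lime_le; first exact: is_cvg_einfs.
  apply: nearW => N; apply: le_trans (TK N).
  by apply: ereal_inf_lbound; exists N => /=.
- apply: mE; exact: measurableT_comp (measurable_second_order_part _ _ mf) (measurable_sample X).
- by move=> w _; rewrite lee_fin; exact: even_pow_ge0.
- move=> w _; rewrite limn_einf_lim; apply: lime_ge; first exact: is_cvg_einfs.
  apply: nearW => N; apply: le_ereal_inf_tmp => _ [k _ <-].
  by rewrite lee_fin; exact: even_pow_ge0.
have aeF := ae_filter_ringOfSetsType P.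
apply: filterS cvg_second_order_part_clamp => w cw _.
apply/esym; apply: (cvg_limn_einf_sup _).1.
apply: cvg_EFin; first exact: nearW.
apply: (@cvg_comp _ _ _ (T^~ w) (fun y : R => y ^+ (2 * m)) _ _ _ cw).
exact: exprn_continuous.
Qed.

End unbounded_kernel.

(** * From Orlicz norms to maxima *)

(** With [s = p / q], raise [t ^ q <= s exp (t ^ q / s)] to the power [s]. *)
Lemma pow_le_expR_powR (R : realType) (q t : R) p : 0 < q -> 0 <= t -> (0 < p)%N ->
  t ^+ p <= ((p%:R / q) `^ q^-1) ^+ p * expR (t `^ q).
Proof.
move=> q0 t0 p0; set s := p%:R / q.
have s0 : 0 < s by rewrite divr_gt0// ltr0n.
have qs : q * s = p%:R by rewrite mulrCA divff ?mulr1// gt_eqF.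
have h : t `^ q <= s * expR (t `^ q / s).
  rewrite mulrC -ler_pdivrMr//; apply: le_trans (expR_ge1Dx _).
  by rewrite lerDr.
have -> : t ^+ p = (t `^ q) `^ s by rewrite -powRrM qs powR_mulrn.
have se0 : 0 <= s * expR (t `^ q / s) by rewrite mulr_ge0 ?expR_ge0// ltW.
apply: le_trans (ge0_ler_powR (ltW s0) _ _ h) _; rewrite ?nnegrE ?powR_ge0//.
rewrite powRM ?expR_ge0 ?(ltW s0)// -expRM divfK ?gt_eqF//.
rewrite -powR_mulrn ?powR_ge0// -powRrM.
by rewrite (_ : q^-1 * p%:R = s) // mulrC.
Qed.

(** The infimum defining the norm need not be attained, hence the admissible
    constant [K < 2 D] in place of [D]. *)
Lemma psi_norm_moment (dO : measure_display) (Omega : measurableType dO)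
    (R : realType) (P : probability Omega R) (q D : R) (xi : Omega -> R) p :
  0 < q -> 0 < D -> (0 < p)%N -> measurable_fun setT xi ->
  (psi_norm P q xi <= D%:E)%E ->
  (\int[P]_w (`|xi w| ^+ p)%:E <=
     (2 * (2 * D * (p%:R / q) `^ q^-1) ^+ p)%:E)%E.
Proof.
move=> q0 D0 p0 mxi xiD.
have : (psi_norm P q xi < (2 * D)%:E)%E.
  by apply: le_lt_trans xiD _; rewrite lte_fin; lra.
move=> /ereal_inf_lt[_ [K [K0 xiK] <-]]; rewrite lte_fin => KD.
pose W := (p%:R / q) `^ q^-1.
have W0 : 0 <= W by exact: powR_ge0.
pose y w := expR ((`|xi w| / K) `^ q) - 1.
have my : measurable_fun setT y.
  apply: measurable_funB => //; apply: measurableT_comp => //.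
  apply: (measurableT_comp (measurable_powR q)).
  apply: measurable_funM => //; exact: measurableT_comp.
have y0 w : 0 <= y w by rewrite subr_ge0 -expR0 ler_expR powR_ge0.
have C0 : 0 <= (K * W) ^+ p by rewrite exprn_ge0// mulr_ge0// ltW.
have yK : (\int[P]_w (y w)%:E <= 1)%E by move: xiK; rewrite unlock.
apply: (@le_trans _ _ (\int[P]_w (((K * W) ^+ p)%:E * ((y w)%:E + 1)))%E).
  apply: ge0_le_integral => //.
  - apply/measurable_EFinP; apply: measurable_funX; exact: measurableT_comp.
  - apply: emeasurable_funM => //; apply: emeasurable_funD => //.
    exact/measurable_EFinP.
  move=> w _; rewrite -EFinD -EFinM lee_fin /y subrK.
  have [u0 xiE] : 0 <= `|xi w| / K /\ `|xi w| = K * (`|xi w| / K).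
    by split; [rewrite divr_ge0// ltW|rewrite mulrCA divff ?mulr1// gt_eqF].
  rewrite {1}xiE; move: u0; move: (`|xi w| / K) => u u0.
  rewrite [K * u]mulrC [K * W]mulrC !exprMn mulrAC ler_wpM2r ?exprn_ge0 ?(ltW K0)//.
  exact: pow_le_expR_powR.
rewrite ge0_integralZl//; last 2 first.
- by apply: emeasurable_funD => //; exact/measurable_EFinP.
- by move=> w _; rewrite -EFinD lee_fin addr_ge0.
rewrite ge0_integralD//; last 2 first.
- by move=> w _; rewrite lee_fin.
- exact/measurable_EFinP.
rewrite integral_cst//= probability_setT mul1e.
apply: (@le_trans _ _ (((K * W) ^+ p)%:E * (1 + 1))%E).
  by apply: lee_wpmul2l; rewrite ?lee_fin// leeD2r.
rewrite -EFinD -EFinM lee_fin mulrC ler_wpM2l//.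
rewrite lerXn2r ?nnegrE ?mulr_ge0 ?(ltW K0) ?(ltW D0)//.
by rewrite ler_wpM2r// ltW.
Qed.

(** For [a > 0], every [u >= 0] satisfies [u <= a + u ^ p / a ^ (p - 1)].  With
    [u = |T_j|], summing over [j] and taking [a = e B] gives
    [a (1 + d e ^ (- p))], which is at most [2 a]. *)
Lemma expectation_bigmax_le (dO : measure_display) (Omega : measurableType dO)
    (R : realType) (P : probability Omega R) (d m : nat) (T : 'I_d -> Omega -> R) (B : R) :
  (0 < m)%N -> 0 < B -> (forall j, measurable_fun setT (T j)) ->
  (forall j, (\int[P]_w (T j w ^+ (2 * m))%:E <= (B ^+ (2 * m))%:E)%E) ->
  d%:R <= expR (2 * m)%:R :> R ->
  ('E_P[fun w => (\big[Num.max/0]_(j < d) `|T j w|)%R] <= (2 * expR 1 * B)%:E)%E.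
Proof.
move=> m0 B0 mT TB dm; set p := (2 * m)%N in TB dm *.
have p0 : (0 < p)%N by rewrite muln_gt0.
have pE : p = p.-1.+1 by rewrite prednK.
pose a : R := expR 1 * B.
have a0 : 0 < a by rewrite mulr_gt0 ?expR_gt0.
pose b : R := (a ^+ p.-1)^-1.
have b0 : 0 < b by rewrite invr_gt0 exprn_gt0.
have mTp j : measurable_fun setT (fun w => (T j w ^+ p)%:E).
  by apply/measurable_EFinP; exact: measurable_funX.
rewrite unlock.
apply: (@le_trans _ _ (\int[P]_w (a%:E + b%:E * \sum_(j < d) (T j w ^+ p)%:E))%E).
  apply: ge0_le_integral => //.
  - by move=> w _; rewrite lee_fin; apply: bigmax_ge_id.
  - apply/measurable_EFinP; elim: (index_enum _) => [|j s IH].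
      by under eq_fun do rewrite big_nil; exact: measurable_cst.
    under eq_fun do rewrite big_cons; apply: measurable_maxr => //.
    exact: measurableT_comp.
  - apply: emeasurable_funD => //; apply: emeasurable_funM => //.
    exact: emeasurable_sum.
  move=> w _; rewrite sumEFin -EFinM -EFinD lee_fin.
  have S0 : 0 <= \sum_(j < d) T j w ^+ p.
    by apply: sumr_ge0 => j _; exact: even_pow_ge0.
  apply: bigmax_le => [|j _].
    by rewrite addr_ge0 ?(ltW a0)// mulr_ge0 ?(ltW b0).
  have [Ta|aT] := leP `|T j w| a.
    by rewrite (le_trans Ta)// lerDl mulr_ge0 ?(ltW b0).
  apply: (@le_trans _ _ (b * T j w ^+ p)); last first.
    apply: (@le_trans _ _ (b * \sum_(j < d) T j w ^+ p)).
      rewrite ler_wpM2l ?(ltW b0)// (bigD1 j)//= lerDl.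
      by apply: sumr_ge0 => k _; exact: even_pow_ge0.
    by rewrite lerDr ltW.
  rewrite -even_pow_norm -/p pE exprSr mulrA ler_peMl//.
  rewrite /b mulrC ler_pdivlMr ?exprn_gt0// mul1r.
  by rewrite lerXn2r ?nnegrE// ltW.
have S0 w : (0 <= \sum_(j < d) (T j w ^+ p)%:E)%E.
  by apply: sume_ge0 => j _; rewrite lee_fin; exact: even_pow_ge0.
have mS : measurable_fun setT (fun w => \sum_(j < d) (T j w ^+ p)%:E)%E.
  exact: emeasurable_sum.
rewrite ge0_integralD//; last 3 first.
- by move=> w _; rewrite lee_fin ltW.
- by move=> w _; rewrite mule_ge0// lee_fin ltW.
- exact: emeasurable_funM.
rewrite integral_cst//= probability_setT mule1.
rewrite ge0_integralZl//; last by rewrite lee_fin ltW.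
rewrite ge0_integral_sum//; last by move=> j w _; rewrite lee_fin; exact: even_pow_ge0.
apply: (@le_trans _ _ (a%:E + b%:E * \sum_(j < d) (B ^+ p)%:E)%E).
  rewrite leeD2l//; apply: lee_wpmul2l; first by rewrite lee_fin ltW.
  exact: lee_sum.
rewrite sumEFin -EFinM -EFinD lee_fin sumr_const card_ord -[_ ^+ _ *+ _]mulr_natl.
have -> : 2 * expR 1 * B = a + a by rewrite /a; ring.
rewrite lerD2l /b mulrC ler_pdivrMr ?exprn_gt0// -exprS -pE /a exprMn.
rewrite ler_wpM2r ?exprn_ge0 ?(ltW B0)//; apply: le_trans dm _.
by rewrite -expRM_natl mulr1.
Qed.

Lemma ln_nat_ge (R : realType) (d : nat) : (3 <= d)%N -> 2 / 3 <= ln d%:R :> R.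
Proof.
move=> d3; have d0 : 0 < d%:R :> R by rewrite ltr0n (leq_trans _ d3).
have := expR_ge1Dx (- ln (d%:R : R)); rewrite expRN lnK ?posrE// => h.
have : d%:R^-1 <= 3^-1 :> R by rewrite lef_pV2 ?posrE// ler_nat.
lra.
Qed.

Theorem theorem5p1 (R : realType) (q : R) (q_gt0 : 0 < q) :
  exists c C : R, [/\ 0 < c, 0 < C &
    forall (n d r : nat) (n_ge4 : (4 <= n)%N) (d_ge3 : (3 <= d)%N)
      (r_ge2 : (2 <= r)%N) (le_rn : (r <= n)%N)
      (dO dS : measure_display) (Omega : measurableType dO)
      (S : measurableType dS) (P : probability Omega R)
      (X : 'I_n -> {RV P >-> S}) (h : {mfun r.-tuple S >-> d.-tuple R})
      (D : R),
      iid X ->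
      symmetric_kernel h ->
      (forall j : 'I_d,
        ('E_P[fun w => `|kernel_rv X h (first_indices le_rn) j w|%R] < +oo)%E) ->
      1 <= D ->
      (forall j : 'I_d,
        (psi_norm P q (fun w => (kernel_rv X h (first_indices le_rn) j w
                                - theta X h le_rn j)%R) <= D%:E)%E) ->
      r%:R ^+ 2 * ln d%:R / n%:R <= c ->
      ('E_P[fun w => (\big[Num.max/0]_(j < d)
          `|(Ustat X h j w - theta X h le_rn j)
            - r%:R / n%:R * \sum_(i < n) (projection X h le_rn j (X i w)
                                          - theta X h le_rn j)|)%R]
        <= (C * (r%:R ^+ 2 * ln d%:R `^ (1 + q^-1) * D / n%:R))%R%:E)%E].
Proof.
pose a : R := (6 / q) `^ q^-1.
have a0 : 0 < a by rewrite powR_gt0// divr_gt0.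
exists 1, (2 * expR 1 * (480 * a)); split => //.
  by rewrite mulr_gt0// ?mulr_gt0 ?expR_gt0.
move=> n d r n_ge4 d_ge3 r_ge2 le_rn dO dS Omega S P X h D iidX hsym hint D1 hpsi _.
pose k0 : 'I_r := Ordinal (ltnW r_ge2).
pose L : R := ln d%:R.
have L23 : 2 / 3 <= L by exact: ln_nat_ge.
have L0 : 0 < L by lra.
(* p = 2 m is an even integer with log d <= p, and m <= 3 log d because
   log d >= 2 / 3. *)
pose m := (Num.truncn L).+1.
have m0 : (0 < m)%N by [].
have Lm : L <= m%:R by rewrite ltW// truncnS_gt.
have mL : m%:R <= 3 * L.
  rewrite /m -natr1; have := truncn_itv (ltW L0); case/andP => h1 _; lra.
pose W : R := ((2 * m)%:R / q) `^ q^-1.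
have W0 : 0 < W by rewrite powR_gt0// divr_gt0// ltr0n muln_gt0.
have D0 : 0 < D by rewrite (lt_le_trans _ D1).
pose rho : R := r%:R ^+ 2 / n%:R.
have n0 : 0 < n%:R :> R by rewrite ltr0n (leq_trans _ n_ge4).
have rho0 : 0 < rho by rewrite divr_gt0// exprn_gt0// ltr0n (leq_trans _ r_ge2).
(* B ^ 2 = 3200 m ^ 2 rho ^ 2 V below, with V = 8 (D W) ^ 2. *)
pose B : R := 160 * (m%:R * rho * (D * W)).
have mR0 : 0 < m%:R :> R by rewrite ltr0n.
have mr0 : 0 < m%:R * rho * (D * W) by rewrite mulr_gt0 // mulr_gt0.
have B0 : 0 < B by rewrite mulr_gt0 ?ltr0n.
pose f j (x : r.-tuple S) : R := tnth (h x) j.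
have mf j : measurable_fun [set: r.-tuple S] (f j).
  exact: measurableT_comp (@measurable_tnth _ _ d j) (measurable_funP h).
have fsym j (s : 'S_r) x : f j [tuple tnth x (s k) | k < r] = f j x.
  by rewrite /f hsym.
have rvE t j w : kernel_rv X h t j w = f j (subtuple t (sample X w)).
  rewrite /kernel_rv /f; congr (tnth (h _) j).
  by apply: eq_from_tnth => k; rewrite !tnth_mktuple.
have mrv t j : measurable_fun setT (fun w => f j (subtuple t (sample X w))).
  exact: measurableT_comp (mf j) (measurableT_comp (measurable_subtuple t) (measurable_sample X)).
have fint j : P.-integrable setT
    (fun w => (f j (subtuple (first_indices le_rn) (sample X w)))%:E).
  apply/integrableP; split; first exact/measurable_EFinP.
  by have := hint j; rewrite unlock; under eq_integral do rewrite rvE.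
have thetaE j : theta X h le_rn j = kernel_mean X le_rn (f j).
  rewrite /theta unlock /kernel_mean /mean /Rintegral; congr fine.
  by apply: eq_integral => w _; rewrite rvE.
have projE j x : projection X h le_rn j x = kernel_projection X le_rn (f j) x.
  by rewrite /projection unlock.
pose T j w := second_order_part X le_rn (f j) (sample X w).
have mT j : measurable_fun setT (T j).
  exact: measurableT_comp (measurable_second_order_part X le_rn (mf j)) (measurable_sample X).
have TB j : (\int[P]_w (T j w ^+ (2 * m))%:E <= (B ^+ (2 * m))%:E)%E.
  pose V : R := 8 * (D * W) ^+ 2.
  have V0 : 0 < V by rewrite mulr_gt0// exprn_gt0// mulr_gt0.
  have -> : B ^+ (2 * m) = (3200 * m%:R ^+ 2 * rho ^+ 2 * V) ^+ m.
    by rewrite exprM; congr (_ ^+ _); rewrite /B /V; ring.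
  apply: (second_order_part_integral_moment iidX (mf j) (fsym j) (erefl : val k0 = 0%N)
    (fint j) (c := theta X h le_rn j)) => //.
  have p0 : (0 < 2 * m)%N by rewrite muln_gt0.
  have mxi : measurable_fun setT (fun w =>
      kernel_rv X h (first_indices le_rn) j w - theta X h le_rn j).
    by apply: measurable_funB => //; rewrite (funext (rvE _ j)); exact: mrv.
  have := psi_norm_moment q_gt0 D0 p0 mxi (hpsi j).
  under eq_integral do rewrite even_pow_norm rvE.
  move=> /le_trans; apply; rewrite lee_fin -/W exprM.
  have -> : V = 2 * (2 * D * W) ^+ 2 by rewrite /V; ring.
  rewrite [leRHS]exprMn; apply: ler_wpM2r; first by rewrite exprn_ge0// sqr_ge0.
  by rewrite ler_eXnr// ler1n.
have dm : d%:R <= expR (2 * m)%:R :> R.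
  have d0 : 0 < d%:R :> R by rewrite ltr0n (leq_trans _ d_ge3).
  rewrite -{1}(@lnK _ d%:R) ?posrE// ler_expR (le_trans Lm)// ler_nat.
  by rewrite leq_pmull.
rewrite (_ : (fun w => _) = (fun w => \big[Num.max/0]_(j < d) `|T j w|)); last first.
  apply/funext => w; apply: eq_bigr => j _; congr `|_|.
  rewrite /T /second_order_part thetaE; congr (_ - _ - _ * _).
    by rewrite /Ustat /kernel_average; congr (_ * _); apply: eq_bigr => t _; rewrite rvE.
  by apply: eq_bigr => i _; rewrite projE tnth_mktuple.
apply: le_trans (expectation_bigmax_le m0 B0 mT TB dm) _; rewrite lee_fin.
have e0 : 0 <= 2 * expR 1 :> R by rewrite mulr_ge0 ?expR_ge0.
rewrite -[leRHS]mulrA ler_wpM2l//.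
have WL : W <= a * L `^ q^-1.
  have q6 : 0 <= 6 / q by rewrite divr_ge0// ltW.
  have mq : 0 <= (2 * m)%:R / q by rewrite divr_ge0// ltW.
  have q6L : 0 <= 6 / q * L by rewrite mulr_ge0// ltW.
  rewrite /a -powRM ?(ltW L0)//.
  apply: ge0_ler_powR; rewrite ?nnegrE ?invr_ge0 ?(ltW q_gt0)//.
  rewrite mulrAC; apply: ler_wpM2r; first by rewrite invr_ge0 ltW.
  by rewrite natrM; lra.
have -> : L `^ (1 + q^-1) = L * L `^ q^-1.
  have LN : L != 0 by rewrite gt_eqF.
  by rewrite powRD ?LN ?implybT// powRr1// ltW.
have -> : 480 * a * (r%:R ^+ 2 * (L * L `^ q^-1) * D / n%:R) =
    160 * (3 * L * rho * (D * (a * L `^ q^-1))) by rewrite /rho; ring.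
rewrite ler_wpM2l//.
apply: ler_pM; rewrite ?mulr_ge0 ?(ltW D0) ?(ltW W0) ?(ltW rho0)//.
- by rewrite ler_wpM2r// ltW.
- by rewrite ler_wpM2l// ltW.
Qed.
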